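(* Let $M$ be a smooth manifold, $X$ a complete vector field on $M$ with flow $\phi^X$, and $\phi:M\times[0,1]\to M$, $\phi(m,s)=\phi^X_s(m)$. Let $\tau:\mathbb{R}\to\{\text{vector fields on }M\}$ be the Lie algebra homomorphism with $\tau(1)=X$ and let $\rho:\mathbb{Z}\to\mathrm{Diff}(M)$, $\rho(n)=\phi^X_n$, be the discrete flow of $X$. Define the linear operator $I:\Omega(M)\to\Omega(M)$ by $$I(\eta)=\int_{[0,1]}\phi^*\eta\wedge\mathrm{pr}_2^*(ds),$$ where the integral denotes integration along the fibers of $\mathrm{pr}_1:M\times[0,1]\to M$. Then $I$ is a homomorphism of differential complexes in the sense that $I\circ d=-d\circ I$. Moreover $I(\mathcal{C}_\tau(M))\subset\Omega_c(M)_\rho$, and the restriction $I:\mathcal{C}_\tau(M)\to\Omega_c(M)_\rho$ is surjective.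
   Context: $\Omega(M)$ is the de Rham complex of $M$ and $\Omega_c(M)=\bigoplus_p\Omega_c^p(M)$ the subcomplex of compactly supported forms. Co-invariant forms: $\Omega_c^p(M)_\rho:=\mathrm{span}\{\omega-\rho(n)^*\omega : n\in\mathbb{Z},\ \omega\in\Omega_c^p(M)\}$, which equals $\{\omega-(\phi^X_1)^*\omega:\omega\in\Omega^p_c(M)\}$; $\Omega_c(M)_\rho=\bigoplus_p\Omega_c^p(M)_\rho$. Divergence forms: $\mathcal{C}^p_\tau(M):=\mathrm{span}\{L_X\omega:\omega\in\Omega_c^p(M)\}$, with $L_X$ the Lie derivative; $\mathcal{C}_\tau(M)=\bigoplus_p\mathcal{C}^p_\tau(M)$. Both are differential subcomplexes of $\Omega_c(M)$. Fiber integration: $\mathrm{pr}_1,\mathrm{pr}_2$ are the projections of $M\times[0,1]$ and $ds$ is the standard volume form on $[0,1]$. The operator $\int_{[0,1]}:\Omega^*(M\times[0,1])\to\Omega^{*-1}(M)$ is normalized by the Stokes formula $\int_{[0,1]}d\Omega=-d\int_{[0,1]}\Omega+\iota_1^*\Omega-\iota_0^*\Omega$, with $\iota_s(m)=(m,s)$; explicitly $\int_{[0,1]}\Omega=\int_0^1\iota_s^*(i_{\partial/\partial s}\Omega)\,ds$. *)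

(* Defs.v *)
(* Built on MathComp-Analysis; the reals are an arbitrary [R : realType].

   Tangent vectors at x are derivations at x of the algebra of smooth
   functions.  The tensor calculus below (differential, pull-back, wedge,
   interior product, d) only uses a set together with its algebra of smooth
   functions, so it applies alike to a manifold M, to [0,1] and to the manifold
   with boundary M x [0,1].

   A p-cochain assigns a number to each p-tuple of tangent vectors at a common
   point; a p-form is a multilinear, alternating, smooth cochain.  Operators
   are defined on all cochains and are meaningful on forms. *)
From HB Require Import structures.
From mathcomp Require Import all_boot all_order all_algebra all_fingroup.
From mathcomp Require Import all_classical all_reals all_analysis.

Set Implicit Arguments.
Unset Strict Implicit.
Unset Printing Implicit Defensive.

Import Order.TTheory GRing.Theory Num.Theory.
Import numFieldNormedType.Exports.

Local Open Scope classical_set_scope.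
Local Open Scope ring_scope.

(* C^k on an open subset A of a finite-dimensional normed space: all iterated
   directional derivatives of order at most k exist and are continuous. *)
Fixpoint Ck {R : realType} {V W : normedModType R} (k : nat) (A : set V)
    (f : V -> W) : Prop :=
  match k with
  | 0%N => forall x, A x -> {for x, continuous f}
  | k'.+1 => forall v, (forall x, A x -> derivable f x v) /\
                       Ck k' A (fun x => 'D_v f x)
  end.

Definition smooth_on {R : realType} {V W : normedModType R} (A : set V)
    (f : V -> W) : Prop := forall k, Ck k A f.

(* [param] is the inverse of [coord]; both are total functions whose values
   are meaningful only on [dom] and on the image of [dom]. *)
Record chart (R : realType) (T : Type) (V : normedModType R) := Chart {
  dom : set T;
  coord : T -> V;
  param : V -> T }.

Definition cim {R : realType} {T : Type} {V : normedModType R}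
    (c : chart T V) : set V := coord c @` dom c.

Definition is_chart {R : realType} {T : topologicalType} {V : normedModType R}
    (c : chart T V) : Prop :=
  [/\ open (dom c), open (cim c),
      (forall x, dom c x -> param c (coord c x) = x),
      (forall x, dom c x -> {for x, continuous (coord c)}) &
      (forall y, cim c y -> {for y, continuous (param c)})].

Definition smooth_compatible {R : realType} {T : Type} {V : normedModType R}
    (c c' : chart T V) : Prop :=
  smooth_on (coord c @` (dom c `&` dom c')) (coord c' \o param c).

Record manifold (R : realType) (n : nat) := Manifold {
  carrier : topologicalType;
  atlas : set (chart carrier 'rV[R]_n);
  manifold_hausdorff : hausdorff_space carrier;
  manifold_second_countable : @second_countable carrier;
  atlas_chart : forall c, atlas c -> is_chart c;
  atlas_cover : forall x, exists2 c, atlas c & dom c x;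
  atlas_compat : forall c c', atlas c -> atlas c' -> smooth_compatible c c' }.

Record smoothSpace (R : realType) := SmoothSpace {
  point :> Type;
  Cinf : set (point -> R) }.

(* For manifolds this is smoothness in charts, thanks to bump functions. *)
Definition smooth_map {R : realType} {S S' : smoothSpace R} (F : S -> S') :=
  forall g, Cinf g -> @Cinf R S (g \o F).

Definition manifold_space {R : realType} {n : nat} (M : manifold R n) :
    smoothSpace R :=
  @SmoothSpace R (carrier M)
    [set f : carrier M -> R | forall c, atlas c -> smooth_on (cim c) (f \o param c)].

Coercion manifold_space : manifold >-> smoothSpace.

Definition I01 (R : realType) : Type := set_type (`[0 : R, 1 : R]%classic).

Section SmoothSpaces.
Variables (R : realType) (n : nat) (M : manifold R n).

(* The product manifold M x R, with the charts c x id. *)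
Definition line_space : smoothSpace R :=
  @SmoothSpace R (M * R)%type
    [set f : M * R -> R | forall c, atlas c ->
       smooth_on (V := ('rV[R]_n * R)%type) (cim c `*` setT)
         (fun q => f (param c q.1, q.2))].

(* Smoothness up to the boundary: for the closed subsets [0,1] of R and
   M x [0,1] of M x R, the smooth functions are the restrictions of the smooth
   functions on the ambient manifold. *)
Definition I01_space : smoothSpace R :=
  @SmoothSpace R (I01 R)
    [set f | exists2 g : R -> R, smooth_on setT g & forall s, f s = g (val s)].

Definition cyl_space : smoothSpace R :=
  @SmoothSpace R (M * I01 R)%type
    [set f | exists2 g : line_space -> R, Cinf g &
       forall m s, f (m, s) = g (m, val s)].

End SmoothSpaces.

Arguments I01_space {R}.

Section Tangent.
Variables (R : realType) (S : smoothSpace R).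

Definition derivation_at (x : S) (v : (S -> R) -> R) : Prop :=
  (forall a f g, Cinf f -> Cinf g ->
     v (fun y => a * f y + g y) = a * v f + v g) /\
  (forall f g, Cinf f -> Cinf g ->
     v (fun y => f y * g y) = v f * g x + f x * v g).

(* A derivation of [Cinf S] at x is represented by its extension by 0 to all
   functions, so that Leibniz equality of tangent vectors is equality of
   derivations. *)
Definition is_tangent (x : S) : pred ((S -> R) -> R) :=
  fun v => `[< derivation_at x v /\ forall f, ~ Cinf f -> v f = 0 >].

Record tangent (x : S) := Tangent {
  tanval :> (S -> R) -> R;
  tanvalP : is_tangent x tanval }.

HB.instance Definition _ x := [isSub for @tanval x].
HB.instance Definition _ x := [Choice of tangent x by <:].

Fact is_tangent_submod_closed x : submod_closed (is_tangent x).
Proof.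
split=> [|a v w /asboolP[[vL vM] v0] /asboolP[[wL wM] w0]]; apply/asboolP.
  by split=> //; split=> *; rewrite ?mulr0 ?mul0r ?addr0.
have E h : (a *: v + w) h = a * v h + w h by [].
split; last by move=> f nf; rewrite E v0 // w0 // mulr0 addr0.
split=> [b f g Cf Cg|f g Cf Cg]; rewrite !E.
  rewrite vL // wL // !mulrDr addrACA; congr (_ + _ + _).
  by rewrite !mulrA [a * b]mulrC.
by rewrite vM // wM // !mulrDr !mulrDl addrACA !mulrA [a * f x]mulrC.
Qed.

HB.instance Definition _ x :=
  GRing.isSubmodClosed.Build R ((S -> R) -> R) (is_tangent x)
    (is_tangent_submod_closed x).
HB.instance Definition _ x := [SubChoice_isSubLmodule of tangent x by <:].

(* The tangent vector at x whose value on smooth functions is D; the zero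
   vector if D is not a derivation at x. *)
Definition mk_tangent (x : S) (D : (S -> R) -> R) : tangent x :=
  insubd 0 (fun f => if `[< Cinf f >] then D f else 0).

Definition vfield := forall x : S, tangent x.

Definition smooth_vfield (V : vfield) : Prop :=
  forall f, Cinf f -> @Cinf R S (fun x => V x f).

Definition bracket (V W : vfield) : vfield :=
  fun x => mk_tangent x (fun f => V x (fun y => W y f) - W x (fun y => V y f)).

End Tangent.

(* The differential of F at x. *)
Definition push {R : realType} {S S' : smoothSpace R} (F : S -> S') (x : S)
    (v : tangent x) : tangent (F x) := mk_tangent (F x) (fun g => v (g \o F)).

Definition cochain (R : realType) (S : smoothSpace R) (p : nat) :=
  forall x : S, ('I_p -> tangent x) -> R.

Section Forms.
Variables (R : realType) (S : smoothSpace R).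

Definition multilinear {p} (w : cochain S p) : Prop :=
  forall (x : S) (v : 'I_p -> tangent x) (i : 'I_p) (a : R) (u u' : tangent x),
    w x (dfwith v i (a *: u + u')) =
    a * w x (dfwith v i u) + w x (dfwith v i u').

Definition alternating {p} (w : cochain S p) : Prop :=
  forall (x : S) (v : 'I_p -> tangent x) (i j : 'I_p),
    i != j -> v i = v j -> w x v = 0.

Definition smooth_cochain {p} (w : cochain S p) : Prop :=
  forall V : 'I_p -> vfield S, (forall i, smooth_vfield (V i)) ->
    @Cinf R S (fun x => w x (fun i => V i x)).

Definition Omega (p : nat) : set (cochain S p) :=
  [set w | [/\ multilinear w, alternating w & smooth_cochain w]].

(* Normalized so that (a /\ b)(u, v) = a(u) b(v) - a(v) b(u) for 1-forms. *)
Definition wedge {p q} (w : cochain S p) (w' : cochain S q) :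
    cochain S (p + q) :=
  fun x v => (p`! * q`!)%:R^-1 *
    \sum_(s : 'S_(p + q)) (-1) ^+ s *
      (w x (fun i => v (s (lshift q i))) * w' x (fun j => v (s (rshift p j)))).

Definition cast_cochain {p q} (e : p = q) (w : cochain S p) : cochain S q :=
  fun x v => w x (fun i => v (cast_ord e i)).

Definition interior {p} (Y : vfield S) (w : cochain S p.+1) : cochain S p :=
  fun x v => w x (fun i => if unlift ord0 i is Some j then v j else Y x).

(* Some smooth vector field with value v at x. *)
Definition extend {x : S} (v : tangent x) : vfield S :=
  xget (fun y => 0) [set V | smooth_vfield V /\ V x = v].

(* The invariant formula
     sum_i (-1)^i V_i (w(V_0, ..^i.., V_p))
     + sum_(i < j) (-1)^(i+j) w([V_i, V_j], V_0, ..^i..^j.., V_p),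
   where in the second sum the bracket has been moved to the place of V_i,
   which costs a factor (-1)^i. *)
Definition koszul {p} (w : cochain S p) (V : 'I_p.+1 -> vfield S) (x : S) : R :=
  \sum_(i < p.+1) (-1) ^+ i * V i x (fun y => w y (fun k => V (lift i k) y)) +
  \sum_(j < p.+1) \sum_(i < p.+1 | (i < j)%N)
    (-1) ^+ j * w x (fun k => if lift j k == i then bracket (V i) (V j) x
                              else V (lift j k) x).

(* For a smooth form the value does not depend on the chosen extensions. *)
Definition dform {p} (w : cochain S p) : cochain S p.+1 :=
  fun x v => koszul w (fun i => extend (v i)) x.

(* Span for the pointwise vector space structure on cochains. *)
Definition span_cochain {p} (A : set (cochain S p)) : set (cochain S p) :=
  [set w | exists (k : nat) (a : 'I_k -> R) (u : 'I_k -> cochain S p),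
     (forall i, A (u i)) /\
     w = (fun x v => \sum_(i < k) a i * u i x v)].

End Forms.

Arguments Omega {R} S p.

Definition pullback {R : realType} {S S' : smoothSpace R} {p : nat}
    (F : S -> S') (w : cochain S' p) : cochain S p :=
  fun x v => w (F x) (fun i => push F (v i)).

Definition Omega_c {R : realType} {n : nat} (M : manifold R n) (p : nat) :
    set (cochain M p) :=
  [set w | Omega M p w /\
     compact (closure [set x : carrier M | exists v, w x v != 0])].

(* The direct sum over p of subspaces A_p of the p-cochains. *)
Definition gcochain (R : realType) (S : smoothSpace R) :=
  forall p : nat, cochain S p.

Section Graded.
Variables (R : realType) (S : smoothSpace R).

Definition gsum (A : forall p, set (cochain S p)) : set (gcochain S) :=
  [set w | (forall p, A p (w p)) /\
     exists N, forall p, (N <= p)%N -> w p = (fun x v => 0)].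

Definition gd (w : gcochain S) : gcochain S :=
  fun p => match p with
           | 0%N => fun x v => 0
           | q.+1 => dform (w q)
           end.

Definition gopp (w : gcochain S) : gcochain S := fun p x v => - w p x v.

Definition glin (a : R) (w w' : gcochain S) : gcochain S :=
  fun p x v => a * w p x v + w' p x v.

End Graded.

Section Cylinder.
Variables (R : realType) (n : nat) (M : manifold R n).

Fact zero_in_I01 : (0 : R) \in (`[0 : R, 1 : R]%classic).
Proof. by rewrite inE /= in_itv /= lexx ler01. Qed.

Definition to_I01 (s : R) : I01 R := insubd (SigSub zero_in_I01) s.

Definition pr2 : cyl_space M -> @I01_space R := fun q => q.2.

Definition iota (s : I01 R) : M -> cyl_space M := fun m => (m, s).

Definition ds : cochain (@I01_space R) 1 := fun s v => v ord0 (fun t => val t).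

(* The derivative is one-sided at the boundary: s^' is taken in [0,1]. *)
Definition ddS : vfield (cyl_space M) := fun q =>
  mk_tangent q (fun f : cyl_space M -> R =>
    lim ((f (q.1, s) - f q) / (val s - val (q.2 : I01 R))
           @[s --> (q.2 : I01 R)^'])).

Definition fibint {p} (w : cochain (cyl_space M) p.+1) : cochain M p :=
  fun m v => \int[lebesgue_measure]_(s in `[0, 1])
               pullback (iota (to_I01 s)) (interior ddS w) v.

End Cylinder.

Section Flow.
Variables (R : realType) (n : nat) (M : manifold R n).

(* X is complete and generates the smooth global flow phi : R x M -> M. *)
Definition complete_flow (X : vfield M) (phi : R -> M -> M) : Prop :=
  [/\ smooth_vfield X,
      smooth_map (fun q : line_space M => phi q.2 q.1),
      (forall m, phi 0 m = m),
      (forall s t m, phi (s + t) m = phi s (phi t m)) &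
      (forall (f : M -> R) m t, @Cinf R M f ->
         is_derive t (1 : R) (fun s => f (phi s m)) (X (phi t m) f))].

Variable phi : R -> M -> M.

Definition rho (k : int) : M -> M := phi k%:~R.

(* L_X w = d/dt (phi_t^* w) at t = 0, pointwise, with phi the flow of X. *)
Definition lie {p} (w : cochain M p) : cochain M p :=
  fun m v => derive1 (fun t => pullback (phi t) w v) 0.

(* The divergence forms of the action tau of the Lie algebra R with
   tau(1) = X, that is tau(t) = t X: the span of the L_X w suffices. *)
Definition divergence_forms : set (gcochain M) :=
  gsum (fun p => span_cochain [set lie w | w in @Omega_c R n M p]).

Definition coinvariant_forms : set (gcochain M) :=
  gsum (fun p => span_cochain
    [set u | exists (k : int) (w : cochain M p), @Omega_c R n M p w /\
       u = (fun m v => w m v - pullback (rho k) w v)]).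

Definition cyl_flow : cyl_space M -> M := fun q => phi (val q.2) q.1.

(* phi^* eta /\ pr_2^* ds has degree p + 1 on the cylinder; integration along
   the fibres brings it back to degree p. *)
Definition Iop (eta : gcochain M) : gcochain M := fun p =>
  fibint (cast_cochain (addn1 p)
    (wedge (pullback cyl_flow (eta p))
           (pullback (@pr2 R n M) (@ds R)))).

End Flow.

(* Main.v *)
From HB Require Import structures.
From mathcomp Require Import all_boot all_order all_algebra all_fingroup.
From mathcomp Require Import all_classical all_reals all_analysis.
From mathcomp Require Import ring lra.
Require Import Defs.

(** The operator I is, in degree p, the average of the pull-backs along the flow,
<<
      I(eta) = (-1)^p \int_0^1 phi_s^* eta ds,
>>
    because the contraction of phi^* eta /\ ds with d/ds, pulled back along
    iota_s, is (-1)^p phi_s^* eta ([Iop_integrand], [IopE]).  The main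
    assertions follow from this formula.

    - I d = - d I: d commutes with each phi_s^* ([dform_pullback]) and with the
      integral ([dform_flow_average]), while the sign changes with the degree.
    - I maps divergence forms to co-invariant forms: phi_s^* L_X w is the
      derivative of phi_s^* w in s ([lie_curve]), so that the fundamental theorem of
      calculus gives I(L_X w) = (-1)^p (phi_1^* w - w) ([flow_average_lie]).
    - Surjectivity: by the same formula the image contains every u - phi_1^* u, and
      w - phi_k^* w is a telescoping sum of such forms.

    That I preserves forms, and that d and the integral may be exchanged, rests on
    the joint smoothness of (x, s) |-> phi_s^* eta evaluated on vector fields
    ([smooth_pullback_flow]).  Tangent vectors being derivations of the algebra of
    smooth functions, this is reduced to calculus in R^n by local frames
    ([exists_frame]), which come from bump functions and Hadamard's lemma; the
    calculus consists of the chain rule for iterated directional derivatives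
    ([Cupto_comp_row]) and of differentiation under the integral sign
    ([is_derive_Rintegral01]).

    As d is defined by the Koszul formula with arbitrarily chosen extensions, one
    needs that the formula depends only on the values of the fields at the point
    ([koszul_tensorial]).  It is antisymmetric ([koszul_perm]), so that it suffices
    to prove its linearity over smooth functions in slot 0; a field vanishing at the
    point is then expanded in a frame. *)

Set Implicit Arguments.
Unset Strict Implicit.
Unset Printing Implicit Defensive.

Import Order.TTheory GRing.Theory Num.Theory.
Import numFieldNormedType.Exports.

Local Open Scope classical_set_scope.
Local Open Scope ring_scope.

(** * Functions of class C^k along directions *)

Lemma near_continuous (T U : topologicalType) (f g : T -> U) x : (\forall y \near x, f y = g y) ->
  {for x, continuous f} -> {for x, continuous g}.
Proof.
move=> fg cf; rewrite /prop_for /continuous_at -(nbhs_singleton fg).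
exact: cvg_trans (near_eq_cvg fg) cf.
Qed.

Section DirectionalCalculus.
Variables (R : realType) (V : normedModType R).
Implicit Types (A B : set V) (f g : V -> R) (k : nat).

(** C^j for every j <= k.  Recording the continuity of f at each stage makes this
    decreasing in k by definition, which lets products and compositions be
    treated by induction on k. *)
Fixpoint Cupto k A f : Prop :=
  (forall x, A x -> {for x, continuous f}) /\
  match k with
  | 0%N => True
  | k'.+1 => forall v, (forall x, A x -> derivable f x v) /\
                       Cupto k' A (fun x => 'D_v f x)
  end.

Lemma Cupto_cont k A f x : Cupto k A f -> A x -> {for x, continuous f}.
Proof. by case: k => [|k] [+ _]; apply. Qed.

Lemma Cupto_is_derive k A f v x : Cupto k.+1 A f -> A x ->
  is_derive x v f ('D_v f x).
Proof. by move=> [_ /(_ v)[df _]] Ax; apply: DeriveDef => //; exact: df. Qed.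

Lemma Cupto_derive k A f v : Cupto k.+1 A f -> Cupto k A ('D_v f).
Proof. by move=> [_ /(_ v)[_]]. Qed.

Lemma Cupto_decr k A f : Cupto k.+1 A f -> Cupto k A f.
Proof.
elim: k f => [|k IH] f [cf df]; first by split.
by split=> // v; have [? ?] := df v; split=> //; exact: IH.
Qed.

Lemma Cupto_leq j k A f : (k <= j)%N -> Cupto j A f -> Cupto k A f.
Proof.
elim: j => [|j IH]; first by rewrite leqn0 => /eqP ->.
by rewrite leq_eqVlt => /predU1P[-> //|kj /Cupto_decr]; exact: IH.
Qed.

Lemma smooth_onE A f : smooth_on A f <-> forall k, Cupto k A f.
Proof.
split=> [sf k|sf k].
  elim: k f sf => [|k IH] f sf; first by split=> //; exact: (sf 0%N).
  split; first exact: (sf 0%N).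
  move=> v; have [dfv _] := sf 1%N v; split=> //.
  by apply: IH => j; have [_] := sf j.+1 v.
move/(_ k): sf; elim: k f => [|k IH] f; first by case.
by case=> _ df v; have [? ?] := df v; split=> //; exact: IH.
Qed.

Lemma Cupto_subset k A B f : A `<=` B -> Cupto k B f -> Cupto k A f.
Proof.
move=> AB; elim: k f => [|k IH] f [cf df]; split=> //.
- by move=> x /AB; exact: cf.
- by move=> x /AB; exact: cf.
- by move=> v; have [dfv sf] := df v; split; [move=> x /AB; exact: dfv|exact: IH].
Qed.

Lemma Cupto_local k A f :
  (forall x, A x -> exists2 B, B x & Cupto k B f) -> Cupto k A f.
Proof.
elim: k f => [|k IH] f H; split=> //.
- by move=> x /H[B Bx /Cupto_cont]; apply.
- by move=> x /H[B Bx /Cupto_cont]; apply.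
- move=> v; split; first by move=> x /H[B Bx /Cupto_is_derive] /(_ v x Bx)[].
  by apply: IH => x /H[B Bx sB]; exists B => //; exact: Cupto_derive.
Qed.

Lemma Cupto_eq k A f g : open A -> (forall x, A x -> f x = g x) ->
  Cupto k A f -> Cupto k A g.
Proof.
move=> oA; have nearA (h h' : V -> R) : (forall x, A x -> h x = h' x) ->
    forall x, A x -> \forall y \near x, h y = h' y.
  by move=> hh' x Ax; near=> y; apply: hh'; near: y; exact: open_nbhs_nbhs.
elim: k f g => [|k IH] f g fg [cf df]; split=> //.
- by move=> x Ax; exact: near_continuous (nearA _ _ fg x Ax) (cf x Ax).
- by move=> x Ax; exact: near_continuous (nearA _ _ fg x Ax) (cf x Ax).
- move=> v; have [dfv sf] := df v; split=> [x Ax|].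
    by apply: (near_eq_derivable (nearA _ _ fg x Ax)); exact: dfv.
  by apply: IH sf => x Ax; apply: near_eq_derive; exact: nearA.
Unshelve. all: by end_near. Qed.

(** The directional derivatives may be exhibited by any formula that is valid on
    A, so that no limit has to be computed. *)
Lemma CuptoS k A f : open A -> (forall x, A x -> {for x, continuous f}) ->
  (forall v, exists2 g, forall x, A x -> is_derive x v f (g x) & Cupto k A g) ->
  Cupto k.+1 A f.
Proof.
move=> oA cf df; split=> // v; have [g dg sg] := df v.
split; first by move=> x /dg [].
by apply: Cupto_eq sg => // x /dg [_ <-].
Qed.

Lemma Cupto_cst k A c : open A -> Cupto k A (fun=> c).
Proof.
move=> oA; elim: k c => [|k IH] c.
  by split=> // x _; exact: cst_continuous.
apply: CuptoS => // [x _|v]; first exact: cst_continuous.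
by exists (fun=> 0) => // x _; exact: is_derive_cst.
Qed.

Lemma Cupto_add k A f g : open A -> Cupto k A f -> Cupto k A g ->
  Cupto k A (fun x => f x + g x).
Proof.
move=> oA; elim: k f g => [|k IH] f g sf sg.
  by split=> // x Ax; apply: cvgD; [exact: (Cupto_cont sf)|exact: (Cupto_cont sg)].
apply: CuptoS => // [x Ax|v].
  by apply: cvgD; [exact: (Cupto_cont sf)|exact: (Cupto_cont sg)].
exists (fun x => 'D_v f x + 'D_v g x).
  move=> x Ax; have dfx := Cupto_is_derive v sf Ax.
  by have dgx := Cupto_is_derive v sg Ax; exact: is_deriveD.
by apply: IH; exact: Cupto_derive.
Qed.

Lemma Cupto_mul k A f g : open A -> Cupto k A f -> Cupto k A g ->
  Cupto k A (fun x => f x * g x).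
Proof.
move=> oA; elim: k f g => [|k IH] f g sf sg.
  by split=> // x Ax; apply: cvgM; [exact: (Cupto_cont sf)|exact: (Cupto_cont sg)].
apply: CuptoS => // [x Ax|v].
  by apply: cvgM; [exact: (Cupto_cont sf)|exact: (Cupto_cont sg)].
exists (fun x => f x * 'D_v g x + g x * 'D_v f x).
  move=> x Ax; have dfx := Cupto_is_derive v sf Ax.
  by have dgx := Cupto_is_derive v sg Ax; exact: is_deriveM.
by apply: Cupto_add => //; apply: IH; (exact: Cupto_decr || exact: Cupto_derive).
Qed.

Lemma Cupto_sum k A (I : Type) (r : seq I) (P : pred I) (F : I -> V -> R) :
  open A -> (forall i, P i -> Cupto k A (F i)) ->
  Cupto k A (fun x => \sum_(i <- r | P i) F i x).
Proof.
move=> oA sF; elim: r => [|i r IH].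
  by apply: Cupto_eq (Cupto_cst k 0 oA) => // x _; rewrite big_nil.
have [Pi|/negbTE Pi] := boolP (P i); last first.
  by apply: Cupto_eq IH => // x _; rewrite big_cons Pi.
apply: (@Cupto_eq k A (fun x => F i x + \sum_(j <- r | P j) F j x)) => //.
  by move=> x _; rewrite big_cons Pi.
by apply: Cupto_add => //; exact: sF.
Qed.

Lemma Cupto_prod k A (I : Type) (r : seq I) (P : pred I) (F : I -> V -> R) :
  open A -> (forall i, P i -> Cupto k A (F i)) ->
  Cupto k A (fun x => \prod_(i <- r | P i) F i x).
Proof.
move=> oA sF; elim: r => [|i r IH].
  by apply: Cupto_eq (Cupto_cst k 1 oA) => // x _; rewrite big_nil.
have [Pi|/negbTE Pi] := boolP (P i); last first.
  by apply: Cupto_eq IH => // x _; rewrite big_cons Pi.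
apply: (@Cupto_eq k A (fun x => F i x * \prod_(j <- r | P j) F j x)) => //.
  by move=> x _; rewrite big_cons Pi.
by apply: Cupto_mul => //; exact: sF.
Qed.

Lemma Cupto_linear k A f : open A -> continuous f ->
  (forall h v x, f (h *: v + x) = h * f v + f x) -> Cupto k A f.
Proof.
move=> oA cf lf; case: k => [|k]; first by split=> // x _; exact: cf.
apply: CuptoS => // [x _|v]; first exact: cf.
exists (fun=> f v); last exact: Cupto_cst.
move=> x _.
split; [apply: (is_cvg_near_cst (f v)) => //|apply/lim_near_cst => //];
  near=> h; rewrite /= lf addrK /GRing.scale/= mulKf //;
  by near: h; exact: nbhs_dnbhs_neq.
Unshelve. all: by end_near. Qed.

(** The mean value theorem, for increments s of either sign. *)
Lemma MVT_line f (x v : V) (s : R) :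
  (forall t, `|t| <= `|s| -> derivable f (t *: v + x) v) ->
  exists2 c, `|c| <= `|s| & f (s *: v + x) - f x = s * 'D_v f (c *: v + x).
Proof.
move=> df; pose g t := f (t *: v + x).
have dg t : `|t| <= `|s| -> is_derive t (1 : R) g ('D_v f (t *: v + x)).
  move=> /df dft; have E : (fun h : R => h^-1 *: ((g \o shift t) (h *: (1 : R)) - g t)) =
      (fun h => h^-1 *: ((f \o shift (t *: v + x)) (h *: v) - f (t *: v + x))).
    apply/funext => h; rewrite /g /= /GRing.scale /= mulr1.
    by rewrite -/(GRing.scale _ _) addrA -scalerDl.
  by split; rewrite /derivable /derive E.
have cg t : `|t| <= `|s| -> {for t, continuous g}.
  by move=> /dg[d _]; apply/differentiable_continuous/derivable1_diffP.
have [s0|s0] := leP 0 s.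
  have in0s t : 0 <= t -> t <= s -> `|t| <= `|s| by move=> *; rewrite !ger0_norm.
  have dg' t : t \in `]0, s[ -> is_derive t (1 : R) g ('D_v f (t *: v + x)).
    by rewrite in_itv /= => /andP[t0 ts]; apply: dg; apply: in0s; exact: ltW.
  have cg' : {within `[0, s], continuous g}.
    apply: continuous_in_subspaceT => t; rewrite inE /= in_itv /= => /andP[t0 ts].
    by apply: cg; exact: in0s.
  have [c] := MVT_segment s0 dg' cg'.
  rewrite in_itv /= => /andP[c0 cs]; rewrite /g scale0r add0r subr0 mulrC => E.
  by exists c => //; exact: in0s.
have ins0 t : s <= t -> t <= 0 -> `|t| <= `|s|.
  by move=> *; rewrite !ler0_norm ?lerN2 // ltW.
have dg' t : t \in `]s, 0[ -> is_derive t (1 : R) g ('D_v f (t *: v + x)).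
  by rewrite in_itv /= => /andP[t0 ts]; apply: dg; apply: ins0; exact: ltW.
have cg' : {within `[s, 0], continuous g}.
  apply: continuous_in_subspaceT => t; rewrite inE /= in_itv /= => /andP[t0 ts].
  by apply: cg; exact: ins0.
have [c] := MVT_segment (ltW s0) dg' cg'.
rewrite in_itv /= => /andP[c0 cs]; rewrite /g scale0r add0r sub0r mulrC mulNr => E.
by exists c; [exact: ins0|rewrite -[RHS]opprK -E opprB].
Qed.

End DirectionalCalculus.

(** The difference quotients of f o L in the direction v are literally those of f
    in the direction dL v.  This covers slices, projections and linear changes
    of variables. *)
Lemma Cupto_affine (R : realType) (V W : normedModType R) k (A : set V)
    (B : set W) (f : W -> R) (L dL : V -> W) : open A -> open B ->
  (forall x, A x -> {for x, continuous L}) ->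
  (forall h v x, L (h *: v + x) = h *: dL v + L x) ->
  (forall x, A x -> B (L x)) ->
  Cupto k B f -> Cupto k A (f \o L).
Proof.
move=> oA oB cL aL AB; elim: k f => [|k IH] f sf.
  by split=> // x Ax; apply: continuous_comp; [exact: cL|exact/(Cupto_cont sf)/AB].
apply: CuptoS => // [x Ax|v].
  by apply: continuous_comp; [exact: cL|exact/(Cupto_cont sf)/AB].
exists (fun x => 'D_(dL v) f (L x)); last first.
  by apply: (IH ('D_(dL v) f)); exact: Cupto_derive.
move=> x /AB /(Cupto_is_derive (dL v) sf)[dx _].
have E : (fun h => h^-1 *: (((f \o L) \o shift x) (h *: v) - (f \o L) x)) =
    (fun h => h^-1 *: ((f \o shift (L x)) (h *: dL v) - f (L x))).
  by apply/funext => h /=; rewrite aL.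
by split; rewrite /derivable /derive E.
Qed.

(** * The chain rule *)

Section ChainRule.
Variables (R : realType) (n : nat).
Implicit Types (B : set 'rV[R]_n) (f : 'rV[R]_n -> R).

Notation e_ i := (delta_mx ord0 i : 'rV[R]_n).

(** The vertices of the path from 0 to k along the coordinate axes. *)
Let trunc (k : 'rV[R]_n) (j : nat) : 'rV[R]_n :=
  \row_(i < n) if (i < j)%N then k ord0 i else 0.

Let norm_trunc (k : 'rV[R]_n) j (l : 'I_n) (c : R) : `|c| <= `|k ord0 l| ->
  `|c *: e_ l + trunc k j| <= `|k| + `|k|.
Proof.
move=> ck; apply: le_trans (ler_normD _ _) _; apply: lerD.
  rewrite normrZ; apply: (@le_trans _ _ `|c|).
    rewrite -[leRHS]mulr1 ler_wpM2l //.
    rewrite [leLHS]/Num.Def.normr/= mx_normrE; apply: bigmax_le => // -[i j'] _.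
    by rewrite mxE; case: (_ && _); rewrite ?normr1 ?normr0.
  apply: le_trans ck _; rewrite [leRHS]/Num.Def.normr/= mx_normrE.
  exact: (le_bigmax _ (fun ij => `|k ij.1 ij.2|) (ord0, l)).
rewrite [leLHS]/Num.Def.normr/= mx_normrE; apply: bigmax_le => // -[i j'] _ /=.
rewrite mxE; case: ifP => _; rewrite ?normr0 //.
rewrite [leRHS]/Num.Def.normr/= mx_normrE.
exact: (le_bigmax _ (fun ij => `|k ij.1 ij.2|) (ord0, j')).
Qed.

(** A function with continuous partial derivatives is differentiable: walk from
    a to a + k along the coordinate axes and use the mean value theorem on each
    leg. *)
Lemma partials_differentiable B f a : open B -> B a -> Cupto 1 B f ->
  forall e : R, 0 < e -> \forall k \near (0 : 'rV[R]_n),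
    `|f (k + a) - f a - \sum_(i < n) k ord0 i * 'D_(e_ i) f a| <= e * `|k|.
Proof.
move=> oB Ba sf e e0; pose e' := e / n.+1%:R.
have e'0 : 0 < e' by rewrite divr_gt0.
have : \forall y \near a, B y /\
    forall i : 'I_n, `|'D_(e_ i) f a - 'D_(e_ i) f y| < e'.
  near=> y; split; first by near: y; exact: open_nbhs_nbhs.
  move=> i; move: i; near: y; apply: filter_forall => /= i.
  by have /cvgrPdist_lt := Cupto_cont (Cupto_derive (e_ i) sf) Ba; exact.
move=> /nbhs_ballP[r /= r0 ar].
near=> k.
have kr : `|k| + `|k| < r.
  rewrite -mulr2n -mulr_natr -ltr_pdivlMr //.
  near: k; apply/nbhs_ballP; exists (r / 2); first exact: divr_gt0.
  by move=> y; rewrite -ball_normE /ball_ /= sub0r normrN.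
pose g j := f (trunc k j + a).
have E : f (k + a) - f a = \sum_(i < n) (g i.+1 - g i).
  rewrite -(big_mkord xpredT (fun i => g i.+1 - g i)) telescope_sumr // /g.
  congr (f (_ + a) - f _).
    by apply/rowP => i; rewrite mxE ltn_ord.
  by rewrite -[LHS]add0r; congr (_ + _); apply/rowP => i; rewrite !mxE ltn0.
rewrite E -sumrB; apply: le_trans (ler_norm_sum _ _ _) _.
apply: (@le_trans _ _ (\sum_(i < n) e' * `|k|)); last first.
  rewrite sumr_const card_ord -mulr_natl mulrA ler_wpM2r //.
  by rewrite /e' mulrCA ler_piMr ?(ltW e0) // ler_pdivrMr // mul1r ler_nat.
apply: ler_sum => i _.
have step : trunc k i.+1 = k ord0 i *: e_ i + trunc k i.
  apply/rowP => j; rewrite !mxE eqxx /= ltnS -val_eqE /=.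
  case: (ltngtP j i) => [_|_|/ord_inj ->]; first by rewrite mulr0 add0r.
    by rewrite mulr0 addr0.
  by rewrite mulr1 addr0.
have near_a c : `|c| <= `|k ord0 i| -> B (c *: e_ i + (trunc k i + a)) /\
    forall l : 'I_n, `|'D_(e_ l) f a - 'D_(e_ l) f (c *: e_ i + (trunc k i + a))| < e'.
  move=> ck; apply: ar; rewrite -ball_normE /ball_ /=.
  rewrite addrA opprD addrCA subrr addr0 normrN.
  exact: le_lt_trans (norm_trunc _ _) kr.
have [|c ck Ec] := @MVT_line R _ f (trunc k i + a) (e_ i) (k ord0 i).
  by move=> c /near_a[Bc _]; case: (Cupto_is_derive (e_ i) sf Bc).
have [_ /(_ i) small] := near_a c ck.
rewrite /g step -[_ + _ + a]addrA Ec -mulrBr normrM mulrC; apply: ler_pM => //.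
  by rewrite distrC ltW.
rewrite [leRHS]/Num.Def.normr/= mx_normrE.
exact: (le_bigmax _ (fun ij => `|k ij.1 ij.2|) (ord0, i)).
Unshelve. all: by end_near. Qed.

(** T moves by increments of the order of h, so the error o(|T (x + hv) - T x|) in
    the linearization of f is o(h). *)
Lemma is_derive_comp_row (V : normedModType R) B f (T : V -> 'rV[R]_n)
    (dT : 'rV[R]_n) (x v : V) :
  open B -> B (T x) -> Cupto 1 B f ->
  (forall i, is_derive x v (fun y => T y ord0 i) (dT ord0 i)) ->
  is_derive x v (f \o T) (\sum_(i < n) dT ord0 i * 'D_(e_ i) f (T x)).
Proof.
move=> oB BTx sf dTi.
have derT : derivable T x v.
  by apply/derivable_mxP => i j; rewrite [i]ord1; case: (dTi j).
have DT : 'D_v T x = dT.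
  by rewrite derive_mx //; apply/rowP => j; rewrite mxE; case: (dTi j).
set q := fun h => h^-1 *: (T (h *: v + x) - T x).
have cq : q h @[h --> 0^'] --> dT by rewrite -DT; exact: derT.
have cT : T (h *: v + x) - T x @[h --> (0 : R)^'] --> (0 : 'rV[R]_n).
  have : h *: q h @[h --> (0 : R)^'] --> (0 : R) *: dT.
    by apply: cvgZ => //; apply: cvg_within_filter; exact: cvg_id.
  rewrite scale0r; apply: cvg_trans; apply: near_eq_cvg; near=> h.
  by rewrite /q scalerA divff ?scale1r //; near: h; exact: nbhs_dnbhs_neq.
suff H : h^-1 *: (f (T (h *: v + x)) - f (T x)) @[h --> (0 : R)^'] -->
    (\sum_(i < n) dT ord0 i * 'D_(e_ i) f (T x)).
  by split; [apply/cvg_ex; eexists; exact: H|exact: cvg_lim H].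
have main : \sum_(i < n) q h ord0 i * 'D_(e_ i) f (T x) @[h --> (0 : R)^'] -->
    \sum_(i < n) dT ord0 i * 'D_(e_ i) f (T x).
  apply: cvg_big => [|i _]; first exact: add_continuous.
  apply: cvgMr_tmp.
  by apply: (@cvg_comp _ _ _ q (fun M : 'rV[R]_n => M ord0 i) _ _ _ cq);
    exact: coord_continuous.
rewrite -[X in _ --> X]addr0.
pose r h := h^-1 *: (f (T (h *: v + x)) - f (T x)) -
            \sum_(i < n) q h ord0 i * 'D_(e_ i) f (T x).
rewrite (_ : (fun h => _) = (fun h => \sum_(i < n) q h ord0 i * 'D_(e_ i) f (T x) + r h)); last first.
  by apply/funext => h /=; rewrite /r [RHS]addrC subrK.
apply: cvgD => //; apply/cvgr0Pnorm_le => e e0.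
pose C := `|dT| + 1; have C0 : 0 < C by rewrite ltr_wpDl.
have est : \forall h \near (0 : R)^', `|f (T (h *: v + x) - T x + T x) - f (T x) -
    \sum_(i < n) (T (h *: v + x) - T x) ord0 i * 'D_(e_ i) f (T x)| <=
    e / C * `|T (h *: v + x) - T x|.
  exact: cT (partials_differentiable oB BTx sf (divr_gt0 e0 C0)).
have qC : \forall h \near (0 : R)^', `|q h| <= C.
  have /cvgrPdist_le/(_ 1 ltr01) := cq; apply: filterS => h H.
  rewrite -(subrKC dT (q h)) (le_trans (ler_normD _ _)) // lerD2l.
  by rewrite distrC.
near=> h.
have h0 : h != 0 by near: h; exact: nbhs_dnbhs_neq.
have rE : r h = h^-1 * (f (T (h *: v + x) - T x + T x) - f (T x) -
    \sum_(i < n) (T (h *: v + x) - T x) ord0 i * 'D_(e_ i) f (T x)).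
  rewrite /r subrK mulrBr; congr (_ - _); rewrite mulr_sumr.
  by apply: eq_bigr => i _; rewrite /q !mxE mulrA.
rewrite rE normrM (@le_trans _ _ (`|h^-1| * (e / C * `|T (h *: v + x) - T x|))) //.
  by rewrite ler_wpM2l //; near: h.
rewrite mulrCA -normrZ -/(q h) (@le_trans _ _ (e / C * C)) //.
  by rewrite ler_wpM2l ?divr_ge0 ?(ltW e0) ?(ltW C0) //; near: h.
by rewrite divfK // gt_eqF.
Unshelve. all: by end_near. Qed.

Lemma continuous_row (V : topologicalType) (T : V -> 'rV[R]_n) x :
  (forall i, {for x, continuous (fun y => T y ord0 i)}) -> {for x, continuous T}.
Proof.
move=> cT; apply/cvgrPdist_lt => e e0.
have cTi : \forall y \near x, forall i : 'I_n, `|T x ord0 i - T y ord0 i| < e.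
  by apply: filter_forall => i; move/cvgrPdist_lt: (cT i) => /(_ e e0).
apply: filterS cTi => y H.
rewrite [ltLHS]/Num.Def.normr/= mx_normrE; apply: bigmax_lt => // -[i j] _ /=.
by rewrite !mxE [i]ord1.
Qed.

(** By the chain rule the derivatives of f o T are sums of products of derivatives
    of the coordinates of T with compositions of the same kind of one order less. *)
Lemma Cupto_comp_row (V : normedModType R) k (A : set V) B f (T : V -> 'rV[R]_n) :
  open A -> open B -> (forall x, A x -> B (T x)) ->
  (forall i, Cupto k A (fun y => T y ord0 i)) ->
  (forall j, Cupto j B f) -> Cupto k A (f \o T).
Proof.
move=> oA oB AB.
have cT l : (forall i, Cupto l A (fun y => T y ord0 i)) ->
    forall x, A x -> {for x, continuous T}.
  by move=> sT x Ax; apply: continuous_row => i; exact: Cupto_cont (sT i) Ax.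
elim: k f => [|k IH] f sT sf.
  by split=> // x Ax; apply: continuous_comp; [exact: cT Ax|exact/(Cupto_cont (sf 0%N))/AB].
apply: CuptoS => // [x Ax|v].
  by apply: continuous_comp; [exact: cT Ax|exact/(Cupto_cont (sf 0%N))/AB].
exists (fun x => \sum_(i < n) 'D_v (fun y => T y ord0 i) x * 'D_(e_ i) f (T x)).
  move=> x Ax; have := @is_derive_comp_row V B f T
    (\row_i 'D_v (fun y => T y ord0 i) x) x v oB (AB _ Ax) (sf 1%N).
  under eq_bigr do rewrite mxE; apply.
  by move=> i; rewrite mxE; apply: Cupto_is_derive (sT i) Ax.
apply: Cupto_sum => // i _; apply: Cupto_mul => //; first exact/Cupto_derive/sT.
apply: (IH ('D_(e_ i) f)) => [l|j]; first exact/Cupto_decr/sT.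
exact: Cupto_derive (sf j.+1).
Qed.

End ChainRule.

(** * Integrals over [0,1] depending on a parameter *)

Lemma continuous_pair (T U V : topologicalType) (f : T -> U) (g : T -> V) x :
  {for x, continuous f} -> {for x, continuous g} ->
  {for x, continuous (fun y => (f y, g y))}.
Proof.
move=> cf cg.
exact: (@cvg_pair _ _ _ (nbhs x) (nbhs (f x)) (nbhs (g x)) _ _ _ f g cf cg).
Qed.

Section ParameterIntegral.
Variables (R : realType) (V : normedModType R).
Implicit Types (A : set V) (F g : V * R -> R).
Notation mu := (@lebesgue_measure R).

Lemma integrable01 (f : R -> R) : continuous f ->
  mu.-integrable `[0, 1] (EFin \o f).
Proof.
move=> cf; apply: continuous_compact_integrable; first exact: segment_compact.
exact: continuous_subspaceT.
Qed.

Lemma dist_Rintegral01 (f g : R -> R) (e : R) : continuous f -> continuous g ->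
  (forall s, 0 <= s <= 1 -> `|f s - g s| <= e) ->
  `|\int[mu]_(s in `[0, 1]) f s - \int[mu]_(s in `[0, 1]) g s| <= e.
Proof.
move=> cf cg fg.
have cfg : continuous (fun s => f s - g s).
  by move=> s; apply: cvgB; [exact: cf|exact: cg].
have cn : continuous (fun s => `|f s - g s|).
  by move=> s; apply: cvg_norm; exact: cfg.
rewrite -RintegralB //; [|exact: integrable01..].
apply: le_trans (le_normr_Rintegral _ _) _ => //; first exact: integrable01.
have -> : e = \int[mu]_(s in `[0, 1]) cst e s.
  rewrite Rintegral_cst // [X in fine X](lebesgue_measure_itv `[0, 1]) /=.
  by rewrite lte_fin ltr01 /= oppr0 addr0 mulr1.
apply: le_Rintegral => //.
- exact: integrable01.
- by apply: integrable01 => s; exact: cst_continuous.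
Qed.

Lemma continuous_lincomb (I : Type) (r : seq I) (a : I -> R) (f : I -> R -> R) :
  (forall i, continuous (f i)) -> continuous (fun s => \sum_(i <- r) a i * f i s).
Proof.
move=> cf s; elim: r => [|i r IH].
  by under eq_fun do rewrite big_nil; exact: cst_continuous.
under eq_fun do rewrite big_cons; apply: cvgD; last exact: IH.
by apply: cvgMl_tmp; exact: cf.
Qed.

Lemma Rintegral01_lincomb (I : Type) (r : seq I) (a : I -> R) (f : I -> R -> R) :
  (forall i, continuous (f i)) ->
  \int[mu]_(s in `[0, 1]) (\sum_(i <- r) a i * f i s) =
  \sum_(i <- r) a i * \int[mu]_(s in `[0, 1]) f i s.
Proof.
move=> cf; elim: r => [|i r IH].
  by under eq_Rintegral do rewrite big_nil; rewrite big_nil Rintegral_cst // mul0r.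
rewrite big_cons -IH -RintegralZl //; last exact: integrable01.
rewrite -RintegralD //.
- by apply: eq_Rintegral => s _; rewrite big_cons.
- by apply: integrable01 => s; apply: cvgMl_tmp; exact: cf.
- by apply: integrable01; exact: continuous_lincomb.
Qed.

Lemma slice_continuous A g x : A x ->
  (forall q, (A `*` setT) q -> {for q, continuous g}) ->
  continuous (fun s => g (x, s)).
Proof.
move=> Ax cg s; apply: (@continuous_comp _ _ _ (fun s => (x, s)) g); last exact: cg.
by apply: continuous_pair; [exact: cst_continuous|exact: cvg_id].
Qed.

(** The tube lemma: [0,1] is compact, so continuity at the points of {x} x [0,1]
    is uniform in s. *)
Lemma uniform_near A g x (e : R) : open A -> A x ->
  (forall q, (A `*` setT) q -> {for q, continuous g}) -> 0 < e ->
  \forall y \near x, forall s : R, 0 <= s <= 1 -> `|g (x, s) - g (y, s)| < e.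
Proof.
move=> oA Ax cg e0.
have /compact_near_coveringP/(_ V (nbhs x)
  (fun y s => `|g (x, s) - g (y, s)| < e)) := @segment_compact R 0 1.
have step (s0 : R) : `[0, 1]%classic s0 -> \forall s \near s0 & y \near x,
    `|g (x, s) - g (y, s)| < e.
  move=> _; have e2 : 0 < e / 2 by rewrite divr_gt0.
  have /cvgrPdist_lt/(_ _ e2) := cg (x, s0) (conj Ax I).
  move=> [[U W] /= [xU sW] UW]; exists (W, U) => //= -[s y] /= [Ws Uy].
  have h1 := UW (x, s) (conj (nbhs_singleton xU) Ws).
  have h2 := UW (y, s) (conj Uy Ws); rewrite /= in h1 h2.
  rewrite -(subrKA (g (x, s0))) (le_lt_trans (ler_normD _ _)) //.
  by rewrite [e]splitr ltrD // distrC.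
move=> /(_ (nbhs_filter x) step); apply: filterS => y H s s01; apply: H.
by rewrite /= in_itv.
Qed.

(** By the mean value theorem each difference quotient of F(., s) is a value of
    its derivative at a point near x, hence close to the derivative at x
    uniformly in s. *)
Lemma is_derive_Rintegral01 A F x v : open A -> A x -> Cupto 1 (A `*` setT) F ->
  is_derive x v (fun z => \int[mu]_(s in `[0, 1]) F (z, s))
    (\int[mu]_(s in `[0, 1]) 'D_(v, 0) F (x, s)).
Proof.
move=> oA Ax sF.
set G := 'D_(v, 0) F.
have cF q : (A `*` setT) q -> {for q, continuous F} by exact: (Cupto_cont sF).
have cG q : (A `*` setT) q -> {for q, continuous G}.
  exact: (Cupto_cont (Cupto_derive (v, 0 : R) sF)).
suff H : h^-1 *: (\int[mu]_(s in `[0, 1]) F (h *: v + x, s) -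
    \int[mu]_(s in `[0, 1]) F (x, s)) @[h --> (0 : R)^'] -->
    \int[mu]_(s in `[0, 1]) G (x, s).
  by split; [apply/cvg_ex; eexists; exact: H|exact: cvg_lim H].
apply/cvgrPdist_le => e e0.
have : \forall y \near x, A y /\
    forall s : R, 0 <= s <= 1 -> `|G (x, s) - G (y, s)| < e.
  apply: filterI; first exact: open_nbhs_nbhs.
  exact: (uniform_near oA Ax cG e0).
have tox : (h *: v + x) @[h --> (0 : R)] --> x.
  rewrite -[X in _ --> X]add0r -(scale0r v); apply: cvgD; last exact: cvg_cst.
  by apply: cvgZr_tmp; exact: cvg_id.
move=> /tox /nbhs_ballP[r /= r0 xr].
near=> h.
have hr : `|h| < r.
  near: h; apply: cvg_within; apply/nbhs_ballP; exists r => // y.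
  by rewrite -ball_normE /ball_ /= sub0r normrN.
have h0 : h != 0 by near: h; exact: nbhs_dnbhs_neq.
have small c : `|c| <= `|h| -> A (c *: v + x) /\
    forall s : R, 0 <= s <= 1 -> `|G (x, s) - G (c *: v + x, s)| < e.
  move=> ch; apply: xr; rewrite -ball_normE /ball_ /= sub0r normrN.
  exact: le_lt_trans hr.
have [Ah _] := small h (lexx _).
have c1 := slice_continuous Ax cF.
have c2 := slice_continuous Ah cF.
have c3 := slice_continuous Ax cG.
have c12 : continuous (fun s => F (h *: v + x, s) - F (x, s)).
  by move=> s; apply: cvgB; [exact: c2|exact: c1].
rewrite -RintegralB //; [|exact: integrable01..].
rewrite /GRing.scale /= -RintegralZl //; last exact: integrable01.
apply: dist_Rintegral01 => //.
  by move=> s; apply: cvgMl_tmp; exact: c12.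
move=> s s01.
have [|c ch] := @MVT_line _ _ F (x, s) (v, 0) h.
  move=> t /small[At _]; apply: ex_derive; apply: Cupto_is_derive sF _.
  by split.
have E (t : R) : t *: (v, 0 : R) + (x, s) = (t *: v + x, s).
  by congr pair; rewrite /= scaler0 add0r.
rewrite !E => ->; rewrite mulKf //.
by have [_ /(_ s s01)/ltW] := small c ch.
Unshelve. all: by end_near. Qed.

Lemma Cupto_Rintegral01 k A F : open A -> Cupto k (A `*` setT) F ->
  Cupto k A (fun z => \int[mu]_(s in `[0, 1]) F (z, s)).
Proof.
move=> oA.
have cI F' : (forall q, (A `*` setT) q -> {for q, continuous F'}) ->
    forall x, A x -> {for x, continuous (fun z => \int[mu]_(s in `[0, 1]) F' (z, s))}.
  move=> cF x Ax; apply/cvgrPdist_le => e e0.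
  have nA : \forall y \near x, A y by exact: open_nbhs_nbhs.
  suff : \forall y \near x, `|\int[mu]_(s in `[0, 1]) F' (x, s) -
      \int[mu]_(s in `[0, 1]) F' (y, s)| <= e by [].
  apply: (filterS _ (filterI nA (uniform_near oA Ax cF e0))) => y [Ay Hy].
  apply: dist_Rintegral01; [exact: slice_continuous cF|exact: slice_continuous cF|].
  by move=> s /Hy/ltW.
elim: k F => [|k IH] F sF.
  by split=> // x Ax; exact: (cI F (fun q Aq => Cupto_cont sF Aq) x Ax).
apply: CuptoS => // [x Ax|v].
  exact: (cI F (fun q Aq => Cupto_cont sF Aq) x Ax).
exists (fun x => \int[mu]_(s in `[0, 1]) 'D_(v, 0) F (x, s)).
  move=> x Ax; apply: is_derive_Rintegral01 oA Ax _.
  exact: (@Cupto_leq _ _ k.+1).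
by apply: (IH ('D_(v, 0) F)); exact: Cupto_derive.
Qed.

End ParameterIntegral.

(** * Smooth bump functions on R^n *)

Section Reciprocal.
Variables (R : realType) (V : normedModType R).
Implicit Types (A : set V) (f : V -> R).

Lemma Cupto_inv k A f : open A -> (forall x, A x -> f x != 0) -> Cupto k A f ->
  Cupto k A (fun x => (f x)^-1).
Proof.
move=> oA f0; elim: k => [|k IH] sf.
  by split=> // x Ax; apply: cvgV; [exact: f0|exact: Cupto_cont sf Ax].
apply: CuptoS => // [x Ax|v].
  by apply: cvgV; [exact: f0|exact: Cupto_cont sf Ax].
exists (fun x => (-1 * ((f x)^-1 * (f x)^-1)) * 'D_v f x).
  move=> x Ax; have [df _] := Cupto_is_derive v sf Ax.
  split; first by apply: derivableV => //; exact: f0.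
  by rewrite deriveV ?f0 // /GRing.scale /= expr2 invfM mulN1r.
have sV := IH (Cupto_decr sf).
apply: Cupto_mul => //; last exact: Cupto_derive.
by apply: Cupto_mul => //; [exact: Cupto_cst|exact: Cupto_mul].
Qed.

(** The case n = 1 of the chain rule, R being identified with row vectors of
    length 1. *)
Lemma Cupto_comp1 k A f (g : R -> R) : open A -> Cupto k A f ->
  (forall j, Cupto j setT g) -> Cupto k A (g \o f).
Proof.
move=> oA sf sg.
pose T y : 'rV[R]_1 := \row_(i < 1) f y.
pose g' (z : 'rV[R]_1) := g (z ord0 ord0).
have E y : (g' \o T) y = (g \o f) y by rewrite /g' /T /= mxE.
apply: (Cupto_eq oA (fun x _ => E x)).
apply: (@Cupto_comp_row _ _ _ _ _ setT) => // [|i|j].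
- exact: openT.
- by apply: Cupto_eq sf => // x _; rewrite mxE.
apply: (@Cupto_affine _ _ _ _ _ setT g (fun z : 'rV[R]_1 => z ord0 ord0)
  (fun z : 'rV[R]_1 => z ord0 ord0)) => //; [exact: openT|exact: openT|..].
- by move=> x _; exact: coord_continuous.
- by move=> h v x; rewrite !mxE.
Qed.

End Reciprocal.

Section Bump.
Variable R : realType.
Implicit Types (p : {poly R}).

(** The functions P(1/x) exp(-1/x), extended by 0; this class is stable under
    differentiation. *)
Definition flat p (x : R) : R := if 0 < x then p.[x^-1] * expR (- x^-1) else 0.

(** Because exp y >= y^(i+2) / (i+2)!.  The factor x^2 to spare forces the
    derivative at 0 to vanish. *)
Lemma flat_le p : exists2 C, 0 <= C & forall x : R, `|flat p x| <= C * x ^+ 2.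
Proof.
exists (\sum_(i < size p) `|p`_i| * (i.+2)`!%:R).
  by apply: sumr_ge0 => i _; rewrite mulr_ge0.
move=> x; rewrite /flat; case: ifPn => [x0|_]; last first.
  rewrite normr0 mulr_ge0 ?sqr_ge0 //.
  by apply: sumr_ge0 => i _; rewrite mulr_ge0.
set y := x^-1; have y0 : 0 < y by rewrite invr_gt0.
rewrite horner_coef normrM (ger0_norm (expR_ge0 _)) mulrC mulr_suml.
apply: (@le_trans _ _ (\sum_(i < size p) `|p`_i| * (y ^+ i * expR (- y)))).
  rewrite mulrC; apply: (@le_trans _ _ ((\sum_(i < size p) `|p`_i| * y ^+ i) * expR (- y))).
    rewrite ler_wpM2r ?expR_ge0 //; apply: le_trans (ler_norm_sum _ _ _) _.
    by apply: ler_sum => i _; rewrite normrM normrX (gtr0_norm y0).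
  by rewrite mulr_suml; apply: ler_sum => i _; rewrite mulrA.
apply: ler_sum => i _; rewrite -mulrA ler_wpM2l //.
have xE : x ^+ 2 = y ^- 2 by rewrite /y exprVn invrK.
rewrite xE ler_pdivlMr ?exprn_gt0 // mulrAC -exprD addn2 expRN.
rewrite ler_pdivrMr ?expR_gt0 // mulrC -ler_pdivrMr ?ltr0n ?fact_gt0 //.
by apply: le_trans (expR_ge1Dxn i.+1 (ltW y0)); rewrite lerDr.
Qed.

Lemma flat_near_gt p (x : R) : 0 < x -> \forall y \near x,
  p.[y^-1] * expR (- y^-1) = flat p y.
Proof.
move=> x0; near=> y.
have y0 : 0 < y by near: y; exact: lt_nbhsr.
by rewrite /flat y0.
Unshelve. all: by end_near. Qed.

Lemma is_derive_flat p (x : R) :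
  is_derive x 1 (flat p) (flat ('X^2 * (p - p^`())) x).
Proof.
have [x0|x0|->] := ltgtP x 0.
- have E : \forall y \near x, 0 = flat p y.
    near=> y; rewrite /flat; case: ifPn => // /lt_trans y0.
    by have : y < 0 by [near: y; exact: lt_nbhsl]; move/y0; rewrite ltxx.
  apply: (near_eq_is_derive E); rewrite /flat ltNge ltW //=.
  exact: is_derive_cst.
- apply: (near_eq_is_derive (flat_near_gt p x0)).
  have xn0 : x != 0 by rewrite gt_eqF.
  have dinv : is_derive x (1 : R) (fun y : R => y^-1) (- x ^- 2).
    split; first by apply: (@derivableV _ _ id).
    by rewrite (@deriveV _ _ id) // derive_id /GRing.scale /= mulr1.
  have dp : is_derive x (1 : R) (fun y => p.[y^-1]) (p^`().[x^-1] * - x ^- 2).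
    exact: (@is_derive1_comp _ (horner p) (fun y => y^-1)).
  have de : is_derive x (1 : R) (fun y : R => expR (- y^-1)) (expR (- x^-1) * - - x ^- 2).
    apply: (@is_derive1_comp _ expR (fun y => - y^-1)).
  apply: is_derive_eq (is_deriveM dp de) _.
  rewrite /flat x0 !(hornerE, hornerXn) /GRing.scale /= exprVn.
  by ring.
rewrite {2}/flat ltxx.
have [C C0 HC] := flat_le p.
have f0 : flat p 0 = 0 by rewrite /flat ltxx.
suff H : h^-1 *: (flat p (h *: 1 + 0) - flat p 0) @[h --> (0 : R)^'] --> (0 : R).
  by split; [apply/cvg_ex; eexists; exact: H|exact: cvg_lim H].
apply/cvgr0Pnorm_le => e e0; near=> h.
have h0 : h != 0 by near: h; exact: nbhs_dnbhs_neq.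
rewrite f0 subr0 addr0 /GRing.scale /= mulr1 normrM.
apply: (@le_trans _ _ (`|h^-1| * (C * h ^+ 2))); first by rewrite ler_wpM2l.
rewrite -real_normK ?num_real // expr2 mulrCA mulrA mulrA normfV mulrAC.
rewrite mulfK ?normr_eq0 //.
apply: (@le_trans _ _ ((C + 1) * `|h|)); first by rewrite ler_wpM2r // lerDl.
rewrite mulrC -ler_pdivlMr ?ltr_wpDl // ltW //.
near: h; apply: dnbhs0_lt; rewrite divr_gt0 // ltr_wpDl //.
Unshelve. all: by end_near. Qed.

Lemma is_derive1_dir (f : R -> R) (x v d : R) :
  is_derive x 1 f d -> is_derive x v f (v * d).
Proof.
move=> [df <-]; have dff : differentiable f x by exact/derivable1_diffP.
split; first exact: diff_derivable.
by rewrite !deriveE // -{1}[v]mulr1 -/(v *: (1 : R)) linearZ.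
Qed.

Lemma Cupto_flat p k : Cupto k setT (flat p).
Proof.
have cf q x : {for x, continuous (flat q)}.
  apply: differentiable_continuous; apply/derivable1_diffP.
  by case: (is_derive_flat q x).
elim: k p => [|k IH] p; first by split=> // x _; exact: cf.
apply: CuptoS => [|x _|v]; [exact: openT|exact: cf|].
exists (fun x => v * flat ('X^2 * (p - p^`())) x).
  by move=> x _; exact/is_derive1_dir/is_derive_flat.
apply: Cupto_mul; [exact: openT|apply: Cupto_cst; exact: openT|exact: IH].
Qed.

Definition smooth_step (x : R) : R := flat 1 x / (flat 1 x + flat 1 (1 - x)).

Lemma flat1_ge0 x : 0 <= flat 1 x.
Proof. by rewrite /flat; case: ifP => // _; rewrite hornerC mul1r expR_ge0. Qed.

Lemma flat1_gt0 x : 0 < x -> 0 < flat 1 x.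
Proof. by move=> x0; rewrite /flat x0 hornerC mul1r expR_gt0. Qed.

Lemma flat1_le0 x : x <= 0 -> flat 1 x = 0.
Proof. by rewrite leNgt /flat => /negbTE ->. Qed.

Lemma smooth_step_le0 x : x <= 0 -> smooth_step x = 0.
Proof. by move=> /flat1_le0; rewrite /smooth_step => ->; rewrite mul0r. Qed.

Lemma smooth_step_ge1 x : 1 <= x -> smooth_step x = 1.
Proof.
move=> x1; rewrite /smooth_step (@flat1_le0 (1 - x)) ?subr_le0 // addr0 divff //.
by rewrite gt_eqF // flat1_gt0 // (lt_le_trans ltr01).
Qed.

Lemma Cupto_smooth_step k : Cupto k setT smooth_step.
Proof.
have s1 : Cupto k setT (fun x : R => flat 1 (1 - x)).
  apply: (@Cupto_affine _ _ _ _ _ setT (flat 1) (fun x : R => 1 - x) (fun x => - x)) => //;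
    [exact: openT|exact: openT| | |exact: Cupto_flat].
  - by move=> x _; apply: cvgB; [exact: cst_continuous|exact: cvg_id].
  - by move=> h v x; rewrite /GRing.scale /=; ring.
apply: Cupto_mul; [exact: openT|exact: Cupto_flat|].
apply: Cupto_inv; [exact: openT| |apply: Cupto_add => //; [exact: openT|exact: Cupto_flat]].
move=> x _; rewrite gt_eqF //.
have [x0|x0] := ltP 0 x; first by rewrite ltr_pwDl ?flat1_gt0 ?flat1_ge0.
by rewrite ltr_wpDl ?flat1_ge0 // flat1_gt0 // subr_gt0 (le_lt_trans x0).
Qed.

Section Plateau.
Variables (n : nat) (a : 'rV[R]_n) (r : R).
Hypothesis r0 : 0 < r.

(** The squares avoid the absolute value, which is not smooth: the argument of
    the i-th factor is >= 1 when |z_i - a_i| <= r and <= 0 when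
    |z_i - a_i| >= 2 r. *)
Definition plateau (z : 'rV[R]_n) : R :=
  \prod_(i < n) smooth_step (2 - (r^-1 * (z ord0 i - a ord0 i)) ^+ 2).

Lemma Cupto_plateau k : Cupto k setT plateau.
Proof.
have oT := @openT 'rV[R]_n.
apply: Cupto_prod => // i _.
apply: (@Cupto_comp1 _ _ _ _ (fun z : 'rV[R]_n => 2 - (r^-1 * (z ord0 i - a ord0 i)) ^+ 2)) => //;
  last exact: Cupto_smooth_step.
have sz : Cupto k setT (fun z : 'rV[R]_n => r^-1 * (z ord0 i - a ord0 i)).
  apply: Cupto_mul => //; first exact: Cupto_cst.
  apply: Cupto_add => //; last exact: Cupto_cst.
  apply: Cupto_linear => //; first exact: coord_continuous.
  by move=> h v x; rewrite !mxE.
apply: (@Cupto_eq _ _ _ _ (fun z : 'rV[R]_n => 2 + -1 *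
   ((r^-1 * (z ord0 i - a ord0 i)) * (r^-1 * (z ord0 i - a ord0 i))))) => //.
  by move=> z _; rewrite expr2 mulN1r.
apply: Cupto_add => //; first exact: Cupto_cst.
by apply: Cupto_mul => //; [exact: Cupto_cst|exact: Cupto_mul].
Qed.

Lemma plateau1 z : `|z - a| <= r -> plateau z = 1.
Proof.
move=> zr; apply: big1 => i _; apply: smooth_step_ge1.
suff : `|r^-1 * (z ord0 i - a ord0 i)| <= 1.
  by rewrite ler_norml => /andP[]; set t := _ * _ => t1 t2; nra.
rewrite normrM normfV (gtr0_norm r0) mulrC ler_pdivrMr // mul1r.
apply: le_trans zr; rewrite [leRHS]/Num.Def.normr/= mx_normrE.
apply: le_trans (le_bigmax _ (fun ij => `|(z - a) ij.1 ij.2|) (ord0, i)).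
by rewrite /= !mxE.
Qed.

Lemma plateau0 z : 2 * r <= `|z - a| -> plateau z = 0.
Proof.
move=> zr; suff [i zi] : exists i, 2 * r <= `|z ord0 i - a ord0 i|.
  rewrite /plateau (bigD1 i) //= smooth_step_le0 ?mul0r // subr_le0.
  rewrite -real_normK ?num_real // normrM normfV (gtr0_norm r0) mulrC.
  have : 2 <= `|z ord0 i - a ord0 i| / r by rewrite ler_pdivlMr.
  by set t := _ / r => t2; nra.
apply: contrapT => nz; have : `|z - a| < 2 * r.
  rewrite [ltLHS]/Num.Def.normr/= mx_normrE; apply: bigmax_lt.
    by rewrite mulr_gt0.
  move=> [i j] _ /=; rewrite ltNge; apply/negP => H; apply: nz; exists j.
  by move: H; rewrite !mxE [i]ord1.
by rewrite ltNge zr.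
Qed.

End Plateau.

End Bump.

(** * Smooth functions on M and on M x R *)

Section SmoothRow.
Variables (R : realType) (V : normedModType R) (n : nat).

Lemma Cupto_near k (A : set V) (f : V -> R) : open A ->
  (forall x, A x -> exists B g, [/\ open B, B x, Cupto k B g &
     \forall y \near x, f y = g y]) -> Cupto k A f.
Proof.
move=> oA H; apply: Cupto_local => x Ax; have [B [g [oB Bx sg fg]]] := H x Ax.
have : nbhs x (fun y => f y = g y) by exact: fg.
rewrite nbhsE => -[U [oU Ux] UE].
exists (U `&` B); first by [].
apply: (@Cupto_eq _ _ _ _ g); first exact: openI.
  by move=> y [Uy _]; rewrite UE.
by apply: Cupto_subset sg => y [].
Qed.

Lemma Cupto_coord k (A : set V) (T : V -> 'rV[R]_n) i : open A ->
  smooth_on A T -> Cupto k A (fun x => T x ord0 i).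
Proof.
move=> oA; elim: k T => [|k IH] T sT.
  split=> // x Ax; apply: (@continuous_comp _ _ _ T (fun M => M ord0 i)).
    exact: (sT 0%N).
  exact: coord_continuous.
apply: CuptoS => // [x Ax|v].
  apply: (@continuous_comp _ _ _ T (fun M => M ord0 i)).
    exact: (sT 0%N).
  exact: coord_continuous.
exists (fun x => 'D_v T x ord0 i).
  move=> x Ax; have [dT _] := sT 1%N v.
  split; first by move/derivable_mxP: (dT x Ax); apply.
  by rewrite derive_mx ?mxE //; exact: dT.
by apply: (IH ('D_v T)) => j; have [_] := sT j.+1 v.
Qed.

End SmoothRow.

Section Charts.
Variables (R : realType) (n : nat) (M : manifold R n).
Implicit Types (c : chart (carrier M) 'rV[R]_n) (f g : M -> R).

Lemma open_cim c : atlas c -> open (cim c).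
Proof. by case/atlas_chart. Qed.

Lemma open_dom c : atlas c -> open (dom c).
Proof. by case/atlas_chart. Qed.

Lemma paramK c x : atlas c -> dom c x -> param c (coord c x) = x.
Proof. by case/atlas_chart => _ _ + _ _; apply. Qed.

Lemma dom_param c y : atlas c -> cim c y -> dom c (param c y).
Proof. by move=> ac [x dx <-]; rewrite paramK. Qed.

Lemma coordK c y : atlas c -> cim c y -> coord c (param c y) = y.
Proof. by move=> ac [x dx <-]; rewrite paramK. Qed.

Lemma cim_coord c x : dom c x -> cim c (coord c x).
Proof. by move=> dx; exists x. Qed.

Lemma param_continuous c y : atlas c -> cim c y -> {for y, continuous (param c)}.
Proof. by case/atlas_chart => _ _ _ _; apply. Qed.

Lemma coord_continuous_at c x : atlas c -> dom c x -> {for x, continuous (coord c)}.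
Proof. by case/atlas_chart => _ _ _ + _; apply. Qed.

Lemma CinfP f : Cinf (f : M -> R) <->
  forall c, atlas c -> forall k, Cupto k (cim c) (f \o param c).
Proof.
by split=> H c ac; [apply/smooth_onE; exact: H|apply/smooth_onE; exact: H].
Qed.

Lemma Cinf_continuous f : Cinf (f : M -> R) -> continuous (f : carrier M -> R).
Proof.
move=> /CinfP sf x; have [c ac dx] := atlas_cover x.
apply: (near_continuous (f := (f \o param c) \o coord c)).
  move: (open_dom ac) => od; near=> y => /=; rewrite paramK //.
  by near: y; exact: open_nbhs_nbhs.
apply: continuous_comp; first exact: coord_continuous_at.
by apply: (Cupto_cont (sf c ac 0%N)); exact: cim_coord.
Unshelve. all: by end_near. Qed.

Lemma Cinf_cst (a : R) : @Cinf _ M (fun=> a).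
Proof. by apply/CinfP => c ac k; apply: Cupto_cst; exact: open_cim. Qed.

Lemma Cinf_add f g : @Cinf _ M f -> @Cinf _ M g -> @Cinf _ M (fun x => f x + g x).
Proof.
move=> /CinfP sf /CinfP sg; apply/CinfP => c ac k.
by apply: Cupto_add; [exact: open_cim|exact: sf|exact: sg].
Qed.

Lemma Cinf_mul f g : @Cinf _ M f -> @Cinf _ M g -> @Cinf _ M (fun x => f x * g x).
Proof.
move=> /CinfP sf /CinfP sg; apply/CinfP => c ac k.
by apply: Cupto_mul; [exact: open_cim|exact: sf|exact: sg].
Qed.

Section LineSpace.
Implicit Types F G : M * R -> R.
Local Notation P c := (fun q : 'rV[R]_n * R => (param c q.1, q.2)).

Lemma open_cimT c : atlas c -> open (cim c `*` [set: R]).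
Proof.
move=> ac; rewrite openE => -[y s] [/= cy _]; exists (cim c, setT) => //=.
split; last exact: filterT.
by apply: open_nbhs_nbhs; split; [exact: open_cim|].
Qed.

Lemma CinflP F : @Cinf _ (line_space M) F <->
  forall c, atlas c -> forall k, Cupto k (cim c `*` setT) (F \o P c).
Proof.
by split=> H c ac; [apply/smooth_onE; exact: H|apply/smooth_onE; exact: H].
Qed.

Lemma Cinfl_local F :
  (forall (x : M) s, exists2 G, @Cinf _ (line_space M) G &
     \forall q \near ((x, s) : carrier M * R), F q = G q) ->
  @Cinf _ (line_space M) F.
Proof.
move=> H; apply/CinflP => c ac k; apply: Cupto_near; first exact: open_cimT.
move=> [y s] [cy _]; have [G /CinflP sG FG] := H (param c y) s.
exists (cim c `*` setT), (G \o P c); split => //; first exact: open_cimT.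
  exact: sG.
have cP : {for (y, s), continuous (P c : _ -> carrier M * R)}.
  apply: continuous_pair; last exact: cvg_snd.
  by apply: continuous_comp; [exact: cvg_fst|exact: param_continuous].
exact: cP FG.
Qed.

Lemma Cinfl_cst (a : R) : @Cinf _ (line_space M) (fun=> a).
Proof. by apply/CinflP => c ac k; apply: Cupto_cst; exact: open_cimT. Qed.

Lemma Cinfl_add F G : @Cinf _ (line_space M) F -> @Cinf _ (line_space M) G ->
  @Cinf _ (line_space M) (fun q => F q + G q).
Proof.
move=> /CinflP sf /CinflP sg; apply/CinflP => c ac k.
by apply: Cupto_add; [exact: open_cimT|exact: sf|exact: sg].
Qed.

Lemma Cinfl_mul F G : @Cinf _ (line_space M) F -> @Cinf _ (line_space M) G ->
  @Cinf _ (line_space M) (fun q => F q * G q).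
Proof.
move=> /CinflP sf /CinflP sg; apply/CinflP => c ac k.
by apply: Cupto_mul; [exact: open_cimT|exact: sf|exact: sg].
Qed.

Lemma Cinfl_slice F s : @Cinf _ (line_space M) F -> @Cinf _ M (fun x => F (x, s)).
Proof.
move=> /CinflP sF; apply/CinfP => c ac k.
apply: (@Cupto_affine _ _ _ _ _ _ (F \o P c) (fun y => (y, s)) (fun v => (v, 0)))
  (sF c ac k); [exact: open_cim|exact: open_cimT|..].
- by move=> x _; apply: continuous_pair; [exact: cvg_id|exact: cst_continuous].
- by move=> h v x; congr pair; rewrite /= scaler0 add0r.
- by move=> x cx; split.
Qed.

Lemma Cinfl_curve F x k : @Cinf _ (line_space M) F ->
  Cupto k setT (fun s => F (x, s)).
Proof.
move=> /CinflP sF; have [c ac dx] := atlas_cover x.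
have := @Cupto_affine _ _ _ k setT _ (F \o P c) (fun s : R => (coord c x, s))
  (fun v => (0, v)) _ (open_cimT ac) _ _ _ (sF c ac k).
have -> : (F \o P c) \o (fun s : R => (coord c x, s)) = fun s => F (x, s).
  by apply/funext => s /=; rewrite paramK.
apply; first exact: openT.
- by move=> s _; apply: continuous_pair; [exact: cst_continuous|exact: cvg_id].
- by move=> h v s; congr pair; rewrite /= scaler0 add0r.
- by move=> s _; split; [exact: cim_coord|].
Qed.

Lemma Cinfl_fst f : @Cinf _ M f -> @Cinf _ (line_space M) (fun q => f q.1).
Proof.
move=> /CinfP sf; apply/CinflP => c ac k.
apply: (@Cupto_affine _ _ _ _ _ _ (f \o param c) fst fst) (sf c ac k);
  [exact: open_cimT|exact: open_cim|..].
- by move=> x _; exact: cvg_fst.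
- by [].
- by move=> x [].
Qed.

Lemma Cinfl_continuous F : @Cinf _ (line_space M) F ->
  continuous (F : carrier M * R -> R).
Proof.
move=> /CinflP sF [x s]; have [c ac dx] := atlas_cover x.
apply: (near_continuous (f := (F \o P c) \o (fun q : carrier M * R => (coord c q.1, q.2)))).
  have : \forall q \near (x, s), dom c q.1.
    apply: (@cvg_fst _ _ (nbhs (x : carrier M)) (nbhs s)).
    by apply: open_nbhs_nbhs; split=> //; exact: open_dom.
  by apply: filterS => -[y t] /= dy; rewrite paramK.
apply: continuous_comp; last first.
  by apply: (Cupto_cont (sF c ac 0%N)); split => //; exact: cim_coord.
apply: continuous_pair; last exact: cvg_snd.
by apply: continuous_comp; [exact: cvg_fst|exact: coord_continuous_at].
Qed.

End LineSpace.

(** * Bump functions on a manifold *)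

Definition ext0 c (g : 'rV[R]_n -> R) : M -> R :=
  fun x => if `[< dom c x >] then g (coord c x) else 0.

Lemma ext0E c (g : 'rV[R]_n -> R) x : dom c x -> ext0 c g x = g (coord c x).
Proof. by move=> dx; rewrite /ext0 asboolT. Qed.

(** At a point outside the domain of c the function vanishes nearby, because the
    image of K in the Hausdorff space M is compact, hence closed; at a point
    inside, the transition map is smooth. *)
Lemma Cinf_ext0 c (K : set 'rV[R]_n) (g : 'rV[R]_n -> R) : atlas c ->
  compact K -> K `<=` cim c -> (forall k, Cupto k (cim c) g) ->
  (forall z, ~ K z -> g z = 0) -> @Cinf _ M (ext0 c g).
Proof.
move=> ac cK Kc sg g0; apply/CinfP => c' ac' k.
apply: Cupto_near; first exact: open_cim.
move=> y cy; have [dy|ndy] := pselect (dom c (param c' y)).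
  have BE : coord c' @` (dom c' `&` dom c) =
      [set z | cim c' z /\ dom c (param c' z)].
    apply/seteqP; split => z.
      by move=> [x [dx dx'] <-]; split; [exact: cim_coord|rewrite paramK].
    move=> [cz dz]; exists (param c' z); last exact: coordK.
    by split=> //; exact: dom_param.
  have oB : open (coord c' @` (dom c' `&` dom c)).
    rewrite BE openE => z [cz dz].
    have : \forall w \near z, dom c (param c' w).
      apply: (param_continuous ac' cz); apply: open_nbhs_nbhs; split=> //.
      exact: open_dom.
    move=> near_dom; apply: filterI near_dom.
    by apply: open_nbhs_nbhs; split; [exact: open_cim|exact: cz].
  exists (coord c' @` (dom c' `&` dom c)), (g \o (coord c \o param c')); split => //.
  - by rewrite BE.
  - apply: (@Cupto_comp_row _ _ _ _ _ (cim c)) => //; first exact: open_cim.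
      by rewrite BE => z [_ dz]; exact: cim_coord.
    by move=> i; apply: Cupto_coord => //; exact: atlas_compat.
  - have : \forall z \near y, (coord c' @` (dom c' `&` dom c)) z.
      by apply: open_nbhs_nbhs; split => //; rewrite BE.
    by apply: filterS; rewrite BE => z [_ dz] /=; rewrite ext0E.
exists setT, (fun=> 0); split=> //; [exact: openT|apply: Cupto_cst; exact: openT|].
have cpK : compact (param c @` K).
  apply: continuous_compact => //; apply: continuous_in_subspaceT => z.
  by rewrite inE => /Kc; exact: param_continuous.
have clK := compact_closed (manifold_hausdorff (m := M)) cpK.
have : \forall z \near y, (~` (param c @` K)) (param c' z).
  apply: (param_continuous ac' cy); apply: open_nbhs_nbhs; split.
    exact: closed_openC.
  by move=> [z /Kc cz E]; apply: ndy; rewrite -E; exact: dom_param.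
apply: filterS => z /= nK; rewrite /ext0; case: ifPn => // /asboolP dz.
apply: g0 => Kz; apply: nK; exists (coord c (param c' z)) => //.
by rewrite paramK.
Qed.

Definition cball (a : 'rV[R]_n) (r : R) : set 'rV[R]_n := [set z | `|z - a| <= r].

Lemma compact_cball a r : 0 < r -> compact (cball a r).
Proof.
move=> r0; apply: bounded_closed_compact.
  exists (`|a| + r); split; first exact: num_real.
  move=> x xa z /= zr; apply: le_trans (ltW xa).
  rewrite -(subrK a z) (le_trans (ler_normD _ _)) // addrC lerD2l.
  exact: zr.
rewrite (_ : cball a r = closed_ball a r); first exact: closed_ball_closed.
by rewrite closed_ballE //; apply/seteqP; split=> z; rewrite /cball /closed_ball_ /= distrC.
Qed.

(** The radius leaves room for a plateau function supported in the chart. *)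
Lemma cball_chart c (U : set (carrier M)) x : atlas c -> dom c x -> nbhs x U ->
  exists2 r : R, 0 < r & forall z, cball (coord c x) (2 * r) z ->
    cim c z /\ U (param c z).
Proof.
move=> ac dx xU; have cx := cim_coord dx.
have : \forall z \near coord c x, cim c z /\ U (param c z).
  apply: filterI; first by apply: open_nbhs_nbhs; split; [exact: open_cim|].
  by apply: (param_continuous ac cx); rewrite paramK.
move=> /nbhs_ballP[e /= e0 H]; exists (e / 3); first by rewrite divr_gt0.
move=> z zr; apply: H; rewrite -ball_normE /ball_ /= distrC.
by apply: le_lt_trans zr _; rewrite mulrA ltr_pdivrMr // mulrC ltr_pM2l // ltr_nat.
Qed.

Lemma Cinf_ext0_plateau c x r (g : 'rV[R]_n -> R) : atlas c -> dom c x -> 0 < r ->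
  cball (coord c x) (2 * r) `<=` cim c -> (forall k, Cupto k (cim c) g) ->
  @Cinf _ M (ext0 c (fun z => plateau (coord c x) r z * g z)).
Proof.
move=> ac dx r0 Kc sg; apply: (Cinf_ext0 ac (@compact_cball (coord c x) (2 * r) _)) => //.
  by rewrite mulr_gt0.
  move=> k; apply: Cupto_mul => //; first exact: open_cim.
  exact: Cupto_subset (Cupto_plateau _ _ _).
move=> z /negP; rewrite -ltNge => /ltW/(plateau0 r0) ->.
by rewrite mul0r.
Qed.

(** A plateau function in a chart, extended by zero. *)
Lemma exists_bump (U : set (carrier M)) x : nbhs x U ->
  exists2 f, @Cinf _ M f & f x = 1 /\ forall y, ~ U y -> f y = 0.
Proof.
move=> xU; have [c ac dx] := atlas_cover x.
have [r r0 H] := cball_chart ac dx xU.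
exists (ext0 c (fun z => plateau (coord c x) r z * 1)).
  apply: Cinf_ext0_plateau => //; first by move=> z /H[].
  by move=> k; apply: Cupto_cst; exact: open_cim.
split; first by rewrite ext0E // mulr1 plateau1 // subrr normr0 ltW.
move=> y nU; rewrite /ext0; case: ifP => // /asboolP dy.
rewrite plateau0 ?mul0r // leNgt; apply/negP => /ltW yr.
by have [_] := H _ yr; rewrite paramK.
Qed.

(** The topology of a manifold is the initial one for its smooth functions. *)
Lemma smooth_map_continuous (F : M -> M) : smooth_map F ->
  continuous (F : carrier M -> carrier M).
Proof.
move=> sF x U /exists_bump[f sf [fx f0]].
have cf := Cinf_continuous (sF _ sf).
have : \forall y \near (x : carrier M), f (F y) != 0.
  have := cf x; rewrite /= => /(_ [set t | t != 0]); apply.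
  rewrite /= fx; apply: open_nbhs_nbhs; split; last by rewrite /= oner_eq0.
  exact: open_neq.
apply: filterS => y /= /eqP fy; apply: contrapT => nU; apply: fy; exact: f0.
Qed.

End Charts.

(** * Hadamard's lemma *)

Section Hadamard.
Variables (R : realType).
Notation mu := (@lebesgue_measure R).

Lemma FTC01 (F f : R -> R) : (forall s, is_derive s (1 : R) F (f s)) ->
  continuous f -> \int[mu]_(s in `[0, 1]) f s = F 1 - F 0.
Proof.
move=> dF cf.
have cF : continuous F.
  move=> s; apply: differentiable_continuous; apply/derivable1_diffP.
  by case: (dF s).
rewrite /Rintegral (@continuous_FTC2 R f F) //.
- exact: continuous_subspaceT.
- split; first by move=> s _; case: (dF s).
  + by apply: cvg_at_right_filter; exact: cF.
  + by apply: cvg_at_left_filter; exact: cF.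
- by move=> s _; rewrite derive1E; case: (dF s).
Qed.

Variable n : nat.
Notation e_ i := (delta_mx ord0 i : 'rV[R]_n).

(** g_i(z) is the integral over t in [0,1] of the i-th partial derivative of h at
    b + t (z - b); the identity is the fundamental theorem of calculus on the
    segment from b to z. *)
Lemma hadamard (h : 'rV[R]_n -> R) (b : 'rV[R]_n) :
  (forall k, Cupto k setT h) -> exists2 g : 'I_n -> 'rV[R]_n -> R,
    (forall i k, Cupto k setT (g i)) &
    (forall i, g i b = 'D_(e_ i) h b) /\
    (forall z, h z = h b + \sum_(i < n) (z ord0 i - b ord0 i) * g i z).
Proof.
move=> sh.
pose T (q : 'rV[R]_n * R) : 'rV[R]_n := \row_i (b ord0 i + q.2 * (q.1 ord0 i - b ord0 i)).
pose G i q := 'D_(e_ i) h (T q).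
have oT := @openT ('rV[R]_n * R)%type.
have sT i k : Cupto k setT (fun q => T q ord0 i).
  apply: (@Cupto_eq _ _ _ _ (fun q : 'rV[R]_n * R => b ord0 i + q.2 * (q.1 ord0 i - b ord0 i))) => //.
    by move=> q _; rewrite mxE.
  apply: Cupto_add => //; first exact: Cupto_cst.
  apply: Cupto_mul => //.
    by apply: Cupto_linear => // q; exact: cvg_snd.
  apply: Cupto_add => //; last exact: Cupto_cst.
  apply: Cupto_linear => //.
    move=> q; apply: (@continuous_comp _ _ _ fst (fun z : 'rV[R]_n => z ord0 i)).
      exact: cvg_fst.
    exact: coord_continuous.
  by move=> r v x; rewrite !mxE.
have sG i k : Cupto k setT (G i).
  apply: (@Cupto_comp_row _ _ _ _ _ setT ('D_(e_ i) h) T) => //; first exact: openT.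
  by move=> j; exact: Cupto_derive (sh j.+1).
exists (fun i z => \int[mu]_(s in `[0, 1]) G i (z, s)).
  move=> i k; apply: Cupto_Rintegral01; first exact: openT.
  by apply: Cupto_subset (sG i k).
have mu1 : fine (mu `[0, 1]) = 1.
  by rewrite [X in fine X](lebesgue_measure_itv `[0, 1]) /= lte_fin ltr01 /= oppr0 addr0.
have sl i z : continuous (fun s => G i (z, s)).
  by apply: (@slice_continuous _ _ setT) => // q _; exact: Cupto_cont (sG i 0%N) _.
split=> [i|z].
  under eq_Rintegral => s _.
    have -> : G i (b, s) = 'D_(e_ i) h b.
      by congr ('D_(e_ i) h _); apply/rowP => j; rewrite mxE subrr mulr0 addr0.
    over.
  by rewrite Rintegral_cst // mu1 mulr1.
pose f s := \sum_(i < n) (z ord0 i - b ord0 i) * G i (z, s).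
rewrite -(Rintegral01_lincomb _ (fun i => z ord0 i - b ord0 i)
  (fun i => sl i z)) -/f.
have dF s : is_derive s (1 : R) (fun t => h (T (z, t))) (f s).
  have := @is_derive_comp_row _ _ _ setT h (fun s => T (z, s))
    (\row_i (z ord0 i - b ord0 i)) s 1 openT I (sh 1%N).
  under eq_bigr do rewrite mxE; apply.
  move=> i; rewrite mxE.
  have -> : (fun s => T (z, s) ord0 i) =
      (fun=> b ord0 i) + (fun t => (z ord0 i - b ord0 i) * t).
    by apply/funext => t; rewrite mxE mulrC.
  rewrite -[X in is_derive _ _ _ X]add0r; apply: is_deriveD.
  by rewrite -[X in is_derive _ _ _ X]mulr1; apply: is_deriveZ.
have cf : continuous f by apply: continuous_lincomb => i; exact: sl.
rewrite (FTC01 dF cf) addrC; suff [-> ->] : T (z, 0) = b /\ T (z, 1) = z by rewrite subrK.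
by split; apply/rowP => j; rewrite mxE /=; ring.
Qed.

End Hadamard.

(** * Tangent vectors and local frames *)

Section TangentCalculus.
Variables (R : realType) (S : smoothSpace R).
Implicit Types (f g : S -> R).

(** On an algebra of smooth functions the test made by [mk_tangent] only involves
    the values of the candidate derivation on smooth functions. *)
Definition Cinf_algebra :=
  (forall a f g, Cinf f -> Cinf g -> @Cinf R S (fun y => a * f y + g y)) /\
  (forall f g, Cinf f -> Cinf g -> @Cinf R S (fun y => f y * g y)).

Lemma tangent_derivation (x : S) (v : tangent x) : derivation_at x v.
Proof. by have /asboolP[] := tanvalP v. Qed.

Lemma tangent_nonsmooth (x : S) (v : tangent x) f : ~ Cinf f -> v f = 0.
Proof. by have /asboolP[_] := tanvalP v; apply. Qed.

Lemma tangent_eq (x : S) (v w : tangent x) :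
  (forall f, Cinf f -> v f = w f) -> v = w.
Proof.
move=> vw; apply: val_inj; apply/funext => f /=.
have [sf|nf] := pselect (Cinf f); first exact: vw.
by rewrite !tangent_nonsmooth.
Qed.

Lemma tangentD (x : S) (v w : tangent x) f : (v + w) f = v f + w f.
Proof. by []. Qed.

Lemma tangentZ (x : S) a (v : tangent x) f : (a *: v) f = a * v f.
Proof. by []. Qed.

Lemma tangent_sum (x : S) (I : Type) (r : seq I) (P : pred I) (F : I -> tangent x) f :
  (\sum_(i <- r | P i) F i) f = \sum_(i <- r | P i) F i f.
Proof. by elim/big_rec2: _ => [//|i y1 y2 _ <-]; rewrite tangentD. Qed.

Section OnFunctions.
Hypothesis algS : Cinf_algebra.

Lemma mk_tangentE (x : S) (D : (S -> R) -> R) f : derivation_at x D -> Cinf f ->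
  mk_tangent x D f = D f.
Proof.
case: algS => aL aM [DL DM] sf; rewrite /mk_tangent insubdK ?asboolT //.
apply/asboolP; split; last by move=> g ng; rewrite asboolF.
split=> [a h g sh sg|h g sh sg]; rewrite !asboolT //; [exact: DL|exact: aL|exact: DM|exact: aM].
Qed.

Variables (x : S) (v : tangent x).

Lemma tan_lin a f g : Cinf f -> Cinf g -> v (fun y => a * f y + g y) = a * v f + v g.
Proof. by case: (tangent_derivation v) => + _; apply. Qed.

Lemma tan_mul f g : Cinf f -> Cinf g -> v (fun y => f y * g y) = v f * g x + f x * v g.
Proof. by case: (tangent_derivation v) => _; apply. Qed.

End OnFunctions.
End TangentCalculus.

Lemma push_derivation (R : realType) (S S' : smoothSpace R) (F : S -> S') (x : S)
    (v : tangent x) : smooth_map F -> derivation_at (F x) (fun g => v (g \o F)).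
Proof.
move=> sF; split=> [a f g sf sg|f g sf sg].
  exact: (tan_lin v a (sF _ sf) (sF _ sg)).
exact: (tan_mul v (sF _ sf) (sF _ sg)).
Qed.

Lemma pushE (R : realType) (S S' : smoothSpace R) (F : S -> S') (x : S)
    (v : tangent x) g : Cinf_algebra S' -> smooth_map F -> Cinf g ->
  push F v g = v (g \o F).
Proof. by move=> aS' sF sg; apply: mk_tangentE => //; exact: push_derivation. Qed.

Section ManifoldTangent.
Variables (R : realType) (n : nat) (M : manifold R n).
Implicit Types (f g : M -> R) (c : chart (carrier M) 'rV[R]_n).

Lemma manifold_algebra : Cinf_algebra M.
Proof.
split=> *; last exact: Cinf_mul.
by apply: Cinf_add => //; apply: Cinf_mul => //; exact: Cinf_cst.
Qed.

Lemma Cinf_sum (I : Type) (r : seq I) (P : pred I) (F : I -> M -> R) :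
  (forall i, P i -> @Cinf R M (F i)) -> @Cinf R M (fun x => \sum_(i <- r | P i) F i x).
Proof.
move=> sF; apply/CinfP => c ac k; apply: Cupto_sum; first exact: open_cim.
by move=> i Pi; have /CinfP := sF i Pi; exact.
Qed.

Lemma Cinf_opp f : @Cinf R M f -> @Cinf R M (fun x => - f x).
Proof.
move=> sf; under eq_fun do rewrite -mulN1r.
by apply: Cinf_mul => //; exact: Cinf_cst.
Qed.

Section AtPoint.
Variables (x : M) (v : tangent x).

Lemma tan_cst (a : R) : v (fun=> a) = 0.
Proof.
have s1 := @Cinf_cst R n M 1.
have v1 : v (fun=> 1) = 0.
  have := tan_mul v s1 s1; rewrite !mulr1 mul1r.
  by move=> /eqP; rewrite -subr_eq subrr eq_sym => /eqP.
have s0 := @Cinf_cst R n M 0.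
have v0 : v (fun=> 0) = 0.
  have := tan_lin v 1 s0 s0; rewrite mulr0 addr0 mul1r.
  by move=> /eqP; rewrite -subr_eq subrr eq_sym => /eqP.
by have := tan_lin v a s1 s0; rewrite v1 v0 mulr1 mulr0 !addr0.
Qed.

Lemma tan_add f g : Cinf f -> Cinf g -> v (fun y => f y + g y) = v f + v g.
Proof.
move=> sf sg; rewrite -[in RHS](mul1r (v f)) -tan_lin //.
by congr (tanval v _); apply/funext => y; rewrite mul1r.
Qed.

Lemma tan_scale a f : Cinf f -> v (fun y => a * f y) = a * v f.
Proof.
by move=> sf; rewrite tan_mul //; [rewrite tan_cst mul0r add0r|exact: Cinf_cst].
Qed.

Lemma tan_opp f : Cinf f -> v (fun y => - f y) = - v f.
Proof.
by move=> sf; under eq_fun do rewrite -mulN1r; rewrite tan_scale // mulN1r.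
Qed.

Lemma tan_sum (I : Type) (r : seq I) (P : pred I) (F : I -> M -> R) :
  (forall i, P i -> Cinf (F i)) ->
  v (fun y => \sum_(i <- r | P i) F i y) = \sum_(i <- r | P i) v (F i).
Proof.
move=> sF; elim: r => [|i r IH].
  by rewrite big_nil; under eq_fun do rewrite big_nil; exact: tan_cst.
rewrite big_cons; have [Pi|/negbTE nPi] := ifPn.
  rewrite -IH -tan_add; [|exact: sF|exact: Cinf_sum].
  by congr (tanval v _); apply/funext => y; rewrite big_cons Pi.
by rewrite -IH; congr (tanval v _); apply/funext => y; rewrite big_cons nPi.
Qed.

(** Tangent vectors are local: multiply the difference by a bump. *)
Lemma tan_local f g : Cinf f -> Cinf g ->
  (\forall y \near (x : carrier M), f y = g y) -> v f = v g.
Proof.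
move=> sf sg fg; have [b sb [bx b0]] := exists_bump fg.
have sd : Cinf (fun y => f y - g y) by apply: Cinf_add => //; exact: Cinf_opp.
have : v (fun y => b y * (f y - g y)) = 0.
  rewrite -(tan_cst 0); congr (tanval v _); apply/funext => y.
  have [->|nfg] := pselect (f y = g y); first by rewrite subrr mulr0.
  by rewrite b0 // mul0r.
rewrite tan_mul // (nbhs_singleton fg) subrr mulr0 add0r bx mul1r.
by rewrite tan_add ?tan_opp //; [move/subr0_eq|exact: Cinf_opp].
Qed.

End AtPoint.

Notation e_ i := (delta_mx ord0 i : 'rV[R]_n).

(** Cut-off coordinates and coordinate fields.  Near y, by Hadamard's lemma,
    f = f(y) + sum_i (x_i - x_i(y)) g_i, and a derivation at y takes the value
    sum_i v(x_i) g_i(y) on the right-hand side, with g_i(y) the i-th partial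
    derivative of f at y.  Multiplying the coordinate fields by the bump chi makes
    the expansion of chi v valid on all of M. *)
Lemma exists_frame c (x : M) : atlas c -> dom c x ->
  exists (chi : M -> R) (xi : 'I_n -> M -> R) (E : 'I_n -> vfield M),
  [/\ Cinf chi /\ (\forall y \near (x : carrier M), chi y = 1),
      (forall i, Cinf (xi i)), (forall i, smooth_vfield (E i)),
      (forall y (v : tangent y), chi y *: v = \sum_(i < n) v (xi i) *: E i y) &
      \forall y \near (x : carrier M), dom c y /\
        forall i f, Cinf f -> E i y f = 'D_(e_ i) (f \o param c) (coord c y)].
Proof.
move=> ac dx; set a := coord c x.
have [r r0 Kc] := cball_chart ac dx (filterT : nbhs (x : carrier M) setT).
have {}Kc : cball a (2 * r) `<=` cim c by move=> z /Kc[].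
have r20 : 0 < r / 2 by rewrite divr_gt0.
have Kc2 : cball a (2 * (r / 2)) `<=` cim c.
  move=> z zr; apply: Kc; apply: le_trans zr _.
  by rewrite ler_pM2l // ler_pdivrMr // ler_peMr ?ltW // ltr1n.
have oc := open_cim ac.
have cstc k : Cupto k (cim c) (fun=> 1 : R) by exact: Cupto_cst.
(* beta is 1 on the support of chi0: there the cut-off coordinates agree with the
   coordinates. *)
pose beta := plateau a r.
pose bet (g : 'rV[R]_n -> R) := ext0 c (fun z => beta z * g z).
pose chi0 := plateau a (r / 2).
pose ch (g : 'rV[R]_n -> R) := ext0 c (fun z => chi0 z * g z).
have sbet (g : 'rV[R]_n -> R) : (forall k, Cupto k (cim c) g) -> @Cinf R M (bet g).
  by move=> sg; exact: Cinf_ext0_plateau.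
have sch (g : 'rV[R]_n -> R) : (forall k, Cupto k (cim c) g) -> @Cinf R M (ch g).
  by move=> sg; exact: Cinf_ext0_plateau.
have schart f k i : Cinf f -> Cupto k (cim c) ('D_(e_ i) (f \o param c)).
  by move=> /CinfP/(_ c ac k.+1)/Cupto_derive.
pose D i (y : M) f := ch ('D_(e_ i) (f \o param c)) y.
have derD i y : derivation_at y (D i y).
  split=> [b f g sf sg|f g sf sg]; rewrite /D /ch /ext0; case: ifPn => [/asboolP dy|_].
  - have df := Cupto_is_derive (e_ i) (((CinfP f).1 sf) c ac 1%N) (cim_coord dy).
    have dg := Cupto_is_derive (e_ i) (((CinfP g).1 sg) c ac 1%N) (cim_coord dy).
    have [_ ->] := is_deriveD (is_deriveZ b df) dg.
    by rewrite /GRing.scale /=; ring.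
  - by rewrite mulr0 addr0.
  - have df := Cupto_is_derive (e_ i) (((CinfP f).1 sf) c ac 1%N) (cim_coord dy).
    have dg := Cupto_is_derive (e_ i) (((CinfP g).1 sg) c ac 1%N) (cim_coord dy).
    have [_ ->] := is_deriveM df dg.
    by rewrite /GRing.scale /= paramK //; ring.
  - by rewrite mul0r mulr0 addr0.
have EE i y f : Cinf f -> mk_tangent y (D i y) f = D i y f.
  by move=> sf; apply: mk_tangentE => //; exact: manifold_algebra.
have near_coord (y : M) (e : R) : dom c y -> 0 < e ->
    \forall z \near (y : carrier M), dom c z /\ `|coord c z - coord c y| < e.
  move=> dy e0; apply: filterI; first by apply: open_nbhs_nbhs; split=> //; exact: open_dom.
  have /cvgrPdist_lt/(_ e e0) := coord_continuous_at ac dy.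
  by apply: filterS => z; rewrite distrC.
exists (ch (fun=> 1)), (fun i => bet (fun z => z ord0 i)), (fun i y => mk_tangent y (D i y)).
split.
- split; first exact: sch.
  apply: filterS (near_coord x (r / 2) dx r20) => y [dy yr].
  by rewrite /ch ext0E // mulr1 /chi0 plateau1 // ltW.
- move=> i; apply: sbet => k; apply: Cupto_linear => //; first exact: coord_continuous.
  by move=> h v z; rewrite !mxE.
- move=> i f sf; rewrite (_ : (fun y => _) = ch ('D_(e_ i) (f \o param c))).
    by apply: sch => k; exact: schart.
  by apply/funext => y; rewrite EE.
- move=> y v; apply: tangent_eq => f sf; rewrite tangent_sum tangentZ.
  under eq_bigr do rewrite tangentZ EE //.
  have [chy0|chy0] := eqVneq (ch (fun=> 1) y) 0.
    rewrite chy0 mul0r big1 // => i _.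
    rewrite /D /ch /ext0; move: chy0; rewrite /ch /ext0; case: ifP; rewrite ?mulr0 //.
    by rewrite mulr1 => _ ->; rewrite mul0r mulr0.
  have dy : dom c y.
    by apply: contrapT => ndy; move/eqP: chy0; apply; rewrite /ch /ext0 asboolF.
  have chE (g : 'rV[R]_n -> R) : ch g y = ch (fun=> 1) y * g (coord c y).
    by rewrite /ch !ext0E // mulr1.
  have yr : `|coord c y - a| < r.
    rewrite ltNge; apply/negP => ry; move: chy0.
    by rewrite /ch ext0E // /chi0 plateau0 ?mul0r ?eqxx // mulrC divfK ?pnatr_eq0.
  under eq_bigr do rewrite /D chE mulrCA.
  rewrite -mulr_sumr; congr (_ * _); set b := coord c y.
  (* Hadamard's lemma is applied to f cut off and transported to the model space. *)
  pose h z := if `[< cim c z >] then beta z * f (param c z) else 0.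
  have sh k : Cupto k setT h.
    apply: Cupto_local => z _; have [cz|ncz] := pselect (cim c z).
      exists (cim c) => //; apply: (@Cupto_eq _ _ _ _ (fun z => beta z * (f \o param c) z)) => //.
        by move=> w cw; rewrite /h asboolT.
      apply: Cupto_mul => //; last by move/CinfP: sf; exact.
      exact: Cupto_subset (Cupto_plateau _ _ _).
    have cK : closed (cball a (2 * r)).
      apply: compact_closed; first exact: norm_hausdorff.
      by apply: compact_cball; rewrite mulr_gt0.
    exists (~` cball a (2 * r)); first by move/Kc.
    apply: (@Cupto_eq _ _ _ _ (fun=> 0)); first exact: closed_openC.
      move=> w /negP; rewrite -ltNge => /ltW wr; rewrite /h; case: ifP => // _.
      by rewrite /beta plateau0 ?mul0r.
    by apply: Cupto_cst; exact: closed_openC.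
  have [g sg [gb gE]] := hadamard b sh.
  have sgc i k : Cupto k (cim c) (g i) by apply: Cupto_subset (sg i k).
  have sxi i : @Cinf R M (bet (fun z => z ord0 i)).
    apply: sbet => k; apply: Cupto_linear => //; first exact: coord_continuous.
    by move=> t w z; rewrite !mxE.
  have near1 : \forall z \near (y : carrier M), dom c z /\ beta (coord c z) = 1.
    have e0 : 0 < r - `|b - a| by rewrite subr_gt0.
    apply: filterS (near_coord y _ dy e0) => z [dz zr]; split => //.
    apply: plateau1 => //; rewrite -(subrKA b) (le_trans (ler_normD _ _)) //.
    by rewrite -lerBrDr ltW.
  have beta1 : beta b = 1 by have [] := nbhs_singleton near1.
  have gbE i : g i b = 'D_(e_ i) (f \o param c) b.
    rewrite gb; apply: near_eq_derive.
    have : \forall z \near b, cim c z /\ `|z - a| < r.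
      apply: filterI; first by apply: open_nbhs_nbhs; split=> //; exact: cim_coord.
      apply/nbhs_ballP; exists (r - `|b - a|); first by rewrite /= subr_gt0.
      move=> z; rewrite -ball_normE /ball_ /= => bz.
      rewrite -(subrKA b) (le_lt_trans (ler_normD _ _)) //.
      by rewrite -ltrBrDr distrC.
    apply: filterS => z [cz zr]; rewrite /h asboolT //= /beta plateau1 ?mul1r //.
    exact: ltW.
  pose G i := bet (g i).
  have sG i : @Cinf R M (G i) by exact: sbet.
  have sdiff i : @Cinf R M (fun z => bet (fun z => z ord0 i) z + - b ord0 i).
    by apply: Cinf_add => //; exact: Cinf_cst.
  have sterm i : @Cinf R M (fun z => (bet (fun z => z ord0 i) z + - b ord0 i) * G i z).
    exact: Cinf_mul.
  have -> : v f = v (fun z => f y + \sum_(i < n)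
      (bet (fun z => z ord0 i) z + - b ord0 i) * G i z).
    apply: tan_local => //.
      by apply: Cinf_add; [exact: Cinf_cst|exact: Cinf_sum].
    apply: filterS near1 => z [dz bz].
    have hE w : dom c w -> beta (coord c w) = 1 -> f w = h (coord c w).
      by move=> dw bw; rewrite /h asboolT ?paramK ?bw ?mul1r //; exact: cim_coord.
    rewrite (hE z) // (hE y) // gE; congr (_ + _); apply: eq_bigr => i _.
    by rewrite /G /bet !ext0E // bz !mul1r.
  rewrite tan_add; [|exact: Cinf_cst|exact: Cinf_sum].
  rewrite tan_cst add0r tan_sum //; apply: eq_bigr => i _.
  rewrite tan_mul // tan_add //; last exact: Cinf_cst.
  rewrite tan_cst addr0 /bet !ext0E // -/b beta1 !mul1r subrr mul0r addr0.
  by rewrite /G /bet ext0E // -/b beta1 mul1r gbE.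
- apply: filterS (near_coord x (r / 2) dx r20) => y [dy yr]; split=> // i f sf.
  by rewrite EE // /D /ch ext0E // /chi0 plateau1 ?mul1r // ltW.
Qed.

End ManifoldTangent.

(** * Vector fields *)

Section VectorFields.
Variables (R : realType) (n : nat) (M : manifold R n).
Implicit Types (f g : M -> R) (V W : vfield M) (c : chart (carrier M) 'rV[R]_n).
Notation mu := (@lebesgue_measure R).
Notation e_ i := (delta_mx ord0 i : 'rV[R]_n).

Lemma smooth_vfield_add V W : smooth_vfield V -> smooth_vfield W ->
  smooth_vfield (fun x => V x + W x).
Proof. by move=> sV sW f sf; apply: Cinf_add; [exact: sV|exact: sW]. Qed.

Lemma smooth_vfield_mul f V : Cinf f -> smooth_vfield V ->
  smooth_vfield (fun x => f x *: V x).
Proof. by move=> sf sV g sg; apply: Cinf_mul; [exact: sf|exact: sV]. Qed.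

Lemma smooth_vfield_sum (I : Type) (r : seq I) (P : pred I) (F : I -> vfield M) :
  (forall i, P i -> smooth_vfield (F i)) ->
  smooth_vfield (fun x => \sum_(i <- r | P i) F i x).
Proof.
move=> sF f sf; under eq_fun do rewrite tangent_sum.
by apply: Cinf_sum => i Pi; exact: sF.
Qed.

Lemma bracket_derivation V W (x : M) : smooth_vfield V -> smooth_vfield W ->
  derivation_at x (fun f => V x (fun y => W y f) - W x (fun y => V y f)).
Proof.
move=> sV sW; split=> [a f g sf sg|f g sf sg].
  under eq_fun do rewrite tan_lin //.
  under [X in _ - tanval _ X]eq_fun do rewrite tan_lin //.
  rewrite !tan_lin; [|exact: sV|exact: sV|exact: sW|exact: sW].
  by ring.
under eq_fun do rewrite tan_mul //.
under [X in _ - tanval _ X]eq_fun do rewrite tan_mul //.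
have [Vf Vg] := (sV f sf, sV g sg); have [Wf Wg] := (sW f sf, sW g sg).
rewrite !tan_add ?tan_mul //; try exact: Cinf_mul.
by ring.
Qed.

Lemma bracketE V W (x : M) f : smooth_vfield V -> smooth_vfield W -> Cinf f ->
  bracket V W x f = V x (fun y => W y f) - W x (fun y => V y f).
Proof.
move=> sV sW sf; apply: mk_tangentE => //; first exact: manifold_algebra.
exact: bracket_derivation.
Qed.

Lemma smooth_bracket V W : smooth_vfield V -> smooth_vfield W ->
  smooth_vfield (bracket V W).
Proof.
move=> sV sW f sf; under eq_fun do rewrite bracketE //.
apply: Cinf_add; [exact/sV/sW|exact/Cinf_opp/sW/sV].
Qed.

(** The combination of the fields of a frame with constant coefficients v(x_i). *)
Lemma exists_extension (x : M) (v : tangent x) : exists2 V : vfield M, smooth_vfield V & V x = v.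
Proof.
have [c ac dx] := atlas_cover x.
have [chi [xi [E [[_ chi1] _ sE spanE _]]]] := exists_frame ac dx.
exists (fun y => \sum_(i < n) v (xi i) *: E i y).
  by apply: smooth_vfield_sum => i _; apply: smooth_vfield_mul => //; exact: Cinf_cst.
by rewrite -spanE (nbhs_singleton chi1) scale1r.
Qed.

Lemma smooth_extend (x : M) (v : tangent x) : smooth_vfield (extend v).
Proof.
have [V sV Vx] := exists_extension v.
by have [] := @xgetPex _ (fun y => 0)
  [set V : vfield M | smooth_vfield V /\ V x = v] (ex_intro _ V (conj sV Vx)).
Qed.

Lemma extendE (x : M) (v : tangent x) : extend v x = v.
Proof.
have [V sV Vx] := exists_extension v.
by have [] := @xgetPex _ (fun y => 0)
  [set V : vfield M | smooth_vfield V /\ V x = v] (ex_intro _ V (conj sV Vx)).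
Qed.

Lemma derive_slice (U : normedModType R) (G : U * R -> R) v y s :
  'D_v (fun z => G (z, s)) y = 'D_(v, 0) G (y, s).
Proof.
suff E : (fun h : R => h^-1 *: (((fun z => G (z, s)) \o shift y) (h *: v) - G (y, s)))
    = (fun h => h^-1 *: ((G \o shift (y, s)) (h *: (v, 0 : R)) - G (y, s))).
  by rewrite /derive E.
by apply/funext => h /=; congr (_ *: (G (_, _) - _)); rewrite /= scaler0 add0r.
Qed.

(** In a chart the field is a combination of partial derivatives with smooth
    coefficients. *)
Lemma Cinfl_vfield V (F : M * R -> R) : smooth_vfield V -> @Cinf _ (line_space M) F ->
  @Cinf _ (line_space M) (fun q => V q.1 (fun m => F (m, q.2))).
Proof.
move=> sV sF; apply/CinflP => c ac k; apply: Cupto_near; first exact: open_cimT.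
move=> [y s] [cy _]; have dy := dom_param ac cy.
have [chi [xi [E [[_ chi1] sxi sE spanE nearE]]]] := exists_frame ac dy.
pose P (q : 'rV[R]_n * R) := (param c q.1, q.2).
exists (cim c `*` setT), (fun q => \sum_(i < n)
  V (param c q.1) (xi i) * 'D_(e_ i, 0 : R) (F \o P) q).
split => //; first exact: open_cimT.
  apply: Cupto_sum; first exact: open_cimT.
  move=> i _; apply: Cupto_mul; first exact: open_cimT.
    by have /Cinfl_fst/CinflP := sV _ (sxi i); exact.
  by apply: Cupto_derive; move/CinflP : sF; exact.
have cP : {for (y, s), continuous (fun q : 'rV[R]_n * R => param c q.1)}.
  by apply: continuous_comp; [exact: cvg_fst|exact: param_continuous].
have oc : \forall q \near (y, s), (cim c `*` [set: R]) q.
  by apply: open_nbhs_nbhs; split=> //; exact: open_cimT.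
apply: filterS (filterI oc (cP _ (filterI chi1 nearE))).
move=> [z t] [[/= cz _] [chiz [dz Ez]]] /=.
have VE f : V (param c z) f = \sum_(i < n) V (param c z) (xi i) * E i (param c z) f.
  have := spanE _ (V (param c z)); rewrite chiz scale1r => {1}->.
  by rewrite tangent_sum.
rewrite VE; apply: eq_bigr => i _; have sFt := Cinfl_slice t sF.
by rewrite (Ez i _ sFt) coordK // -(derive_slice (F \o P)).
Qed.

Lemma Cinfl_curve_continuous (F : M * R -> R) (x : M) : @Cinf _ (line_space M) F ->
  continuous (fun s => F (x, s)).
Proof. by move=> sF s; exact: (Cupto_cont (Cinfl_curve x 0%N sF)). Qed.

Lemma tangent_curve_continuous (F : M * R -> R) (x : M) (v : tangent x) :
  @Cinf _ (line_space M) F -> continuous (fun s => v (fun m => F (m, s))).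
Proof.
move=> sF; have [V sV <-] := exists_extension v.
exact: Cinfl_curve_continuous (Cinfl_vfield sV sF).
Qed.

Lemma Cinf_Rintegral (F : M * R -> R) : @Cinf _ (line_space M) F ->
  @Cinf _ M (fun m => \int[mu]_(s in `[0, 1]) F (m, s)).
Proof.
move=> /CinflP sF; apply/CinfP => c ac k.
exact: (Cupto_Rintegral01 (open_cim ac) (sF c ac k)).
Qed.

(** A tangent vector is a combination of partial derivatives in a chart, which may
    be taken under the integral sign. *)
Lemma tangent_Rintegral (F : M * R -> R) (x : M) (v : tangent x) :
  @Cinf _ (line_space M) F ->
  v (fun m => \int[mu]_(s in `[0, 1]) F (m, s)) =
  \int[mu]_(s in `[0, 1]) v (fun m => F (m, s)).
Proof.
move=> sF; have [c ac dx] := atlas_cover x.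
have [chi [xi [E [[_ chi1] sxi sE spanE nearE]]]] := exists_frame ac dx.
have vE f : v f = \sum_(i < n) v (xi i) * E i x f.
  have := spanE x v; rewrite (nbhs_singleton chi1) scale1r => {1}->.
  by rewrite tangent_sum.
rewrite vE; under [RHS]eq_Rintegral do rewrite vE.
rewrite Rintegral01_lincomb; last by move=> i; exact: tangent_curve_continuous.
apply: eq_bigr => i _; congr (_ * _).
have [_ Ex] := nbhs_singleton nearE.
rewrite Ex; last exact: Cinf_Rintegral.
pose P (q : 'rV[R]_n * R) := (param c q.1, q.2).
have /CinflP/(_ c ac 1%N) sFc := sF.
have [_ ->] := is_derive_Rintegral01 (e_ i) (open_cim ac) (cim_coord dx) sFc.
apply: eq_Rintegral => s _; rewrite (Ex i _ (Cinfl_slice s sF)).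
by rewrite -(derive_slice (F \o P)).
Qed.

End VectorFields.

(** * Alternating cochains and permutations *)

Section Antisymmetry.
Variables (R : realType) (S : smoothSpace R).

Definition antisymmetric_cochain {p} (w : cochain S p) :=
  forall (x : S) (v : 'I_p -> tangent x) (s : 'S_p),
    w x (fun i => v (s i)) = (-1) ^+ s * w x v.

Lemma dfwith_eq (T : Type) p (v u : 'I_p -> T) i a :
  u i = a -> (forall j, j != i -> u j = v j) -> u = dfwith v i a.
Proof.
move=> ui uj; apply/funext => j; have [->|ji] := eqVneq j i.
  by rewrite dfwithin.
by rewrite dfwithout 1?eq_sym // uj.
Qed.

Lemma multilinearD p (w : cochain S p) (x : S) (v : 'I_p -> tangent x) i u u' :
  multilinear w -> w x (dfwith v i (u + u')) = w x (dfwith v i u) + w x (dfwith v i u').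
Proof. by move=> /(_ x v i 1 u u'); rewrite scale1r mul1r. Qed.

Lemma multilinear0 p (w : cochain S p) (x : S) (v : 'I_p -> tangent x) i :
  multilinear w -> w x (dfwith v i 0) = 0.
Proof.
move=> mw; have := multilinearD v i 0 0 mw; rewrite addr0.
by move=> /eqP; rewrite -subr_eq subrr eq_sym => /eqP.
Qed.

Lemma multilinearZ p (w : cochain S p) (x : S) (v : 'I_p -> tangent x) i a u :
  multilinear w -> w x (dfwith v i (a *: u)) = a * w x (dfwith v i u).
Proof.
by move=> mw; have := mw x v i a u 0; rewrite addr0 multilinear0 // addr0.
Qed.

(** By polarization a transposition changes the sign; every permutation is a
    product of transpositions. *)
Lemma alternating_antisymmetric p (w : cochain S p) :
  multilinear w -> alternating w -> antisymmetric_cochain w.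
Proof.
move=> mw aw.
have swap (x : S) (v : 'I_p -> tangent x) (i j : 'I_p) : i != j ->
    w x (fun k => v (tperm i j k)) = - w x v.
  move=> ij; have ji : j != i by rewrite eq_sym.
  pose F a b := w x (dfwith (dfwith v i a) j b).
  have Fjj a : F a a = 0.
    apply: (aw _ _ i j) => //; rewrite dfwithin dfwithout //.
    by rewrite dfwithin.
  have FD2 a b b' : F a (b + b') = F a b + F a b' by exact: multilinearD.
  have FC a b : dfwith (dfwith v i a) j b = dfwith (dfwith v j b) i a.
    apply: dfwith_eq; first by rewrite dfwithout // dfwithin.
    move=> k ki; have [->|kj] := eqVneq k j; first by rewrite !dfwithin.
    by rewrite !dfwithout // eq_sym.
  have FD1 a a' b : F (a + a') b = F a b + F a' b.
    by rewrite /F !FC; exact: multilinearD.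
  have -> : w x (fun k => v (tperm i j k)) = F (v j) (v i).
    congr (w x _); apply: dfwith_eq; first by rewrite tpermR.
    move=> k kj; have [->|ki] := eqVneq k i; first by rewrite tpermL dfwithin.
    by rewrite dfwithout 1?eq_sym // tpermD // eq_sym.
  have -> : w x v = F (v i) (v j).
    congr (w x _); apply: dfwith_eq => // k kj.
    have [->|ki] := eqVneq k i; first by rewrite dfwithin.
    by rewrite dfwithout // eq_sym.
  have := Fjj (v i + v j); rewrite FD2 !FD1 !Fjj add0r addr0 => /eqP.
  by rewrite addr_eq0 => /eqP.
move=> x v s; have [ts -> dts] := prod_tpermP s; elim: ts dts v => [|[i j] ts IH] /= dts v.
  rewrite big_nil odd_perm1 mul1r; congr (w x _); apply/funext => k.
  by rewrite perm1.
move: dts => /andP[ij dts]; rewrite big_cons odd_permM odd_tperm ij.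
set s' := (\prod_(t <- ts) _)%g.
transitivity (w x (fun k => (fun l => v (s' l)) (tperm i j k))).
  by congr (w x _); apply/funext => k; rewrite permM.
rewrite (swap _ (fun l => v (s' l))) // IH //; case: (odd_perm s') => /=.
  by rewrite expr0 expr1 mulN1r mul1r opprK.
by rewrite expr0 expr1 mulN1r mul1r.
Qed.

End Antisymmetry.

(** Deleting the entry b of s changes the sign by (-1)^(b + s b), as in the Laplace
    expansion of a determinant. *)
Lemma perm_lift p (s : 'S_p.+1) (b : 'I_p.+1) : exists2 t : 'S_p,
  (forall k : 'I_p, s (lift b k) = lift (s b) (t k)) &
  s = odd b (+) odd (s b) (+) t :> bool.
Proof.
have sl k : exists l, s (lift b k) = lift (s b) l.
  case: (unliftP (s b) (s (lift b k))) => [l ->|/perm_inj E]; first by exists l.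
  by have := neq_lift b k; rewrite E eqxx.
pose t0 k := sval (cid (sl k)).
have t0E k : s (lift b k) = lift (s b) (t0 k) by rewrite /t0; case: cid.
have t0I : injective t0.
  by move=> k l E; apply: (@lift_inj _ b); apply: (@perm_inj _ s); rewrite !t0E E.
exists (perm t0I) => [k|]; first by rewrite permE t0E.
rewrite -odd_lift_perm; congr odd_perm; apply/permP => k.
case: (unliftP b k) => [l ->|->]; last by rewrite lift_perm_id.
by rewrite lift_perm_lift permE t0E.
Qed.

Lemma signr_xor3 (R : ringType) (a b c d : bool) : a = b (+) c (+) d ->
  (-1) ^+ b * (-1) ^+ d = (-1) ^+ a * (-1) ^+ c :> R.
Proof. by move=> ->; rewrite -!signr_addb; congr (_ ^+ _); case: b c d => [] [] []. Qed.

Lemma sum_pairs (R : numFieldType) p (T : 'I_p -> 'I_p -> R) :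
  (forall i j, i != j -> T i j = T j i) ->
  \sum_(j < p) \sum_(i < p | (i < j)%N) T i j =
  2^-1 * \sum_(j < p) \sum_(i < p | i != j) T i j.
Proof.
move=> sT; set A := LHS.
suff -> : \sum_(j < p) \sum_(i < p | i != j) T i j = 2 * A by rewrite mulKf.
have -> : \sum_(j < p) \sum_(i < p | i != j) T i j =
    A + \sum_(j < p) \sum_(i < p | (j < i)%N) T i j.
  rewrite -big_split /=; apply: eq_bigr => j _.
  rewrite (bigID (fun i : 'I_p => (i < j)%N)) /=; congr (_ + _); apply: eq_bigl => i.
    by rewrite -val_eqE /=; case: ltngtP.
  by rewrite -val_eqE /=; case: ltngtP.
rewrite mulr_natl mulr2n; congr (_ + _).
rewrite (exchange_big_dep xpredT) //=; apply: eq_bigr => j _.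
by apply: eq_bigr => i ij; rewrite sT // -val_eqE /= gtn_eqF.
Qed.

(** * The Koszul formula *)

Lemma vfield_eq (R : realType) (S : smoothSpace R) (V W : vfield S) :
  (forall x, V x = W x) -> V = W.
Proof. by move=> VW; apply: functional_extensionality_dep. Qed.

Section Koszul.
Variables (R : realType) (n : nat) (M : manifold R n) (p : nat).
Variable w : cochain M p.
Arguments w : clear implicits.
Hypotheses (mw : multilinear w) (aw : alternating w) (sw : smooth_cochain w).
Implicit Types (V W : 'I_p.+1 -> vfield M) (x : M) (f : M -> R) (H Y Z U : vfield M).

Let antiw := alternating_antisymmetric mw aw.
Let smoothV V := forall i, smooth_vfield (V i).

(** The terms of the second sum, for all ordered pairs of indices: they turn out
    to be symmetric, so that the sum over i < j is half the sum over i != j and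
    permutations of the fields merely reindex it. *)
Let pairterm V x (a b : 'I_p.+1) := (-1) ^+ nat_of_ord b * w x (fun k : 'I_p =>
  if lift b k == a then bracket (V a) (V b) x else V (lift b k) x).

Let koszulE V x : koszul w V x =
  \sum_(i < p.+1) (-1) ^+ i * V i x (fun y => w y (fun k => V (lift i k) y)) +
  \sum_(j < p.+1) \sum_(i < p.+1 | (i < j)%N) pairterm V x i j.
Proof. by []. Qed.

Let sw_lift V (i : 'I_p.+1) : smoothV V -> @Cinf R M (fun y => w y (fun k => V (lift i k) y)).
Proof. by move=> sV; apply: (sw (V := fun k => V (lift i k))) => k; exact: sV. Qed.

Let pairterm_perm V x (s : 'S_p.+1) a b :
  pairterm (fun i => V (s i)) x a b = (-1) ^+ s * pairterm V x (s a) (s b).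
Proof.
have [t tE ts] := perm_lift s b.
rewrite /pairterm; set u := (X in _ = _ * (_ * w x X)).
have -> : (fun k : 'I_p => if lift b k == a then bracket (V (s a)) (V (s b)) x
                   else V (s (lift b k)) x) = fun k => u (t k).
  by apply/funext => k; rewrite /u -tE (inj_eq perm_inj).
rewrite (antiw u t) mulrA [RHS]mulrA; congr (_ * _).
by rewrite -signr_odd -[(-1) ^+ (s b : nat)]signr_odd; exact: signr_xor3.
Qed.

Let pairtermC V x a b : a != b -> smoothV V -> pairterm V x a b = pairterm V x b a.
Proof.
move=> ab sV; have [t tE ts] := perm_lift (tperm a b) b.
rewrite tpermR in tE ts; rewrite odd_tperm ab /= in ts.
rewrite /pairterm; set u := fun k => if lift a k == b then _ else _.
have -> : w x u = (-1) ^+ t * w x (fun k => u (t k)).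
  by rewrite (antiw u t) mulrA -signr_addb addbb mul1r.
have [k0 E0] : exists k, lift b k = a.
  by case: (unliftP b a) ab => [k ->|->]; [exists k|rewrite eqxx].
set u0 := fun k => V (lift b k) x.
have -> : (fun k => u (t k)) = dfwith u0 k0 (bracket (V b) (V a) x).
  apply: dfwith_eq; first by rewrite /u -tE E0 tpermL eqxx.
  move=> k kk0; rewrite /u -tE tpermD //.
  - by rewrite eq_sym (negbTE (neq_lift b k)).
  - by rewrite -E0; rewrite (inj_eq lift_inj) eq_sym.
  - exact: neq_lift.
have -> : (fun k => if lift b k == a then bracket (V a) (V b) x else V (lift b k) x) =
    dfwith u0 k0 (bracket (V a) (V b) x).
  apply: dfwith_eq; first by rewrite E0 eqxx.
  by move=> k kk0; rewrite -E0 (inj_eq lift_inj) (negbTE kk0).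
have -> : bracket (V b) (V a) x = (-1) *: bracket (V a) (V b) x.
  apply: tangent_eq => f sf; rewrite tangentZ !bracketE //; ring.
rewrite multilinearZ // !mulrA; congr (_ * _).
rewrite -mulrA -[(-1) ^+ b]signr_odd -[(-1) ^+ a]signr_odd.
move: ts; case: (odd b); case: (odd a); case: (odd_perm t) => //= _;
  by rewrite ?expr0 ?expr1; ring.
Qed.

(** The linearity of the formula need then only be studied in slot 0, where no
    signs intervene. *)
Lemma koszul_perm V x (s : 'S_p.+1) : smoothV V ->
  koszul w (fun i => V (s i)) x = (-1) ^+ s * koszul w V x.
Proof.
move=> sV; rewrite !koszulE mulrDr; congr (_ + _).
  rewrite mulr_sumr [RHS](reindex_inj (@perm_inj _ s)) /=.
  apply: eq_bigr => i _; have [t tE ts] := perm_lift s i.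
  have -> : (fun y => w y (fun k => V (s (lift i k)) y)) =
      fun y => (-1) ^+ t * w y (fun k => V (lift (s i) k) y).
    apply/funext => y; rewrite -(antiw (fun k => V (lift (s i) k) y) t).
    by congr (w _ _); apply/funext => k; rewrite tE.
  rewrite tan_scale; last exact: sw_lift.
  rewrite !mulrA; congr (_ * _).
  by rewrite -signr_odd -[(-1) ^+ (s i : nat)]signr_odd; exact: signr_xor3.
rewrite !sum_pairs; last first.
- by move=> i j ij; apply: pairtermC => // k; exact: sV.
- by move=> i j ij; apply: pairtermC.
rewrite [RHS]mulrCA; congr (_ * _); rewrite mulr_sumr.
rewrite [RHS](reindex_inj (@perm_inj _ s)) /=; apply: eq_bigr => j _.
rewrite mulr_sumr [RHS](reindex_inj (@perm_inj _ s)) /=.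
apply: eq_big => [i|i _]; first by rewrite (inj_eq perm_inj).
exact: pairterm_perm.
Qed.

Let smooth_dfwith V i H : smoothV V -> smooth_vfield H -> smoothV (dfwith V i H).
Proof.
move=> sV sH j; have [->|ji] := eqVneq j i; first by rewrite dfwithin.
by rewrite dfwithout // eq_sym.
Qed.

Let bracket_linear f Y Z U x : Cinf f -> smooth_vfield Y -> smooth_vfield Z ->
  smooth_vfield U -> bracket (fun y => f y *: Y y + Z y) U x =
  f x *: bracket Y U x + (bracket Z U x + (- U x f) *: Y x).
Proof.
move=> sf sY sZ sW; have sH : smooth_vfield (fun y => f y *: Y y + Z y).
  by apply: smooth_vfield_add => //; exact: smooth_vfield_mul.
apply: tangent_eq => g sg; rewrite bracketE // !tangentD !tangentZ !bracketE //.
have -> : (fun y => (f y *: Y y + Z y) g) = (fun y => f y * Y y g + Z y g) by [].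
rewrite tan_add; [|by apply: Cinf_mul => //; exact: sY|exact: sZ].
by rewrite tan_mul //; [ring|exact: sY].
Qed.

(** The derivative of f produced by the first sum of the Koszul formula cancels
    against the one produced by the brackets. *)
Let koszul_linear0 V f Y Z x : smoothV V -> Cinf f -> smooth_vfield Y ->
  smooth_vfield Z ->
  koszul w (dfwith V ord0 (fun y => f y *: Y y + Z y)) x =
  f x * koszul w (dfwith V ord0 Y) x + koszul w (dfwith V ord0 Z) x.
Proof.
move=> sV sf sY sZ.
have zE' (j : 'I_p) : exists z : 'I_p, lift (lift ord0 j) z = ord0.
  case: (unliftP (lift ord0 j) ord0) => [z E|E]; first by exists z.
  by have := neq_lift ord0 j; rewrite -E eqxx.
have [z zE] := choice zE'.
have nz (j k : 'I_p) : k != z j -> ord0 != lift (lift ord0 j) k.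
  by move=> kz; rewrite -{1}(zE j) (inj_eq lift_inj) eq_sym.
pose u j y := fun k => V (lift (lift ord0 j) k) y.
pose g0 y := w y (fun k => V (lift ord0 k) y).
pose A j (H : vfield M) := V (lift ord0 j) x (fun y => w y (dfwith (u j y) (z j) (H y))).
pose B j (H : vfield M) :=
  w x (dfwith (u j x) (z j) (bracket H (V (lift ord0 j)) x)).
pose C i j (H : vfield M) := w x (dfwith (fun k => if lift (lift ord0 j) k == i
  then bracket (V i) (V (lift ord0 j)) x else u j x k) (z j) (H x)).
have E H : koszul w (dfwith V ord0 H) x = H x g0 +
    \sum_(j < p) (-1) ^+ (lift ord0 j) * (A j H + (B j H +
      \sum_(i < p.+1 | (i < lift ord0 j)%N && (i != ord0)) C i j H)).
  have out j : dfwith V ord0 H (lift ord0 j) = V (lift ord0 j).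
    by rewrite dfwithout.
  have uE j y : (fun k => dfwith V ord0 H (lift (lift ord0 j) k) y) =
      dfwith (u j y) (z j) (H y).
    apply: dfwith_eq; first by rewrite zE dfwithin.
    by move=> k kz; rewrite dfwithout //; exact: nz.
  rewrite koszulE big_ord_recl expr0 mul1r dfwithin -addrA; congr (_ + _).
    congr (tanval _ _); apply/funext => y; congr (w _ _); apply/funext => k.
    by rewrite out.
  rewrite [X in _ + X]big_ord_recl [X in _ + (X + _)]big_pred0 // add0r -big_split /=.
  apply: eq_bigr => j _; rewrite mulrDr; congr (_ + _).
    by rewrite out /A; congr (_ * tanval _ _); apply/funext => y; rewrite uE.
  rewrite (bigD1 ord0) //= mulrDr mulr_sumr; congr (_ + _).
    rewrite /pairterm /B dfwithin out; congr (_ * w _ _); apply: dfwith_eq.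
      by rewrite zE.
    by move=> k /nz kz; rewrite eq_sym (negbTE kz) dfwithout.
  apply: eq_bigr => i /andP[_ i0].
  rewrite /pairterm /C out (@dfwithout _ _ V ord0 H i) 1?eq_sym //; congr (_ * w _ _).
  apply: dfwith_eq; first by rewrite zE eq_sym (negbTE i0) dfwithin.
  by move=> k /nz kz; rewrite dfwithout.
have sg j (H : vfield M) : smooth_vfield H ->
    @Cinf R M (fun y => w y (dfwith (u j y) (z j) (H y))).
  move=> sH; have := sw_lift (lift ord0 j) (smooth_dfwith ord0 sV sH).
  congr (Cinf _); apply/funext => y; congr (w _ _); apply: dfwith_eq.
    by rewrite zE dfwithin.
  by move=> k kz; rewrite dfwithout //; exact: nz.
rewrite !E mulrDr [RHS]addrACA; congr (_ + _).
rewrite mulr_sumr -big_split /=; apply: eq_bigr => j _.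
rewrite mulrCA -mulrDr; congr (_ * _).
have -> : A j (fun y => f y *: Y y + Z y) = f x * A j Y + A j Z +
    V (lift ord0 j) x f * w x (dfwith (u j x) (z j) (Y x)).
  rewrite /A; have -> : (fun y => w y (dfwith (u j y) (z j) (f y *: Y y + Z y))) =
      (fun y => f y * w y (dfwith (u j y) (z j) (Y y)) +
                w y (dfwith (u j y) (z j) (Z y))).
    by apply/funext => y; exact: mw.
  rewrite tan_add; [|by apply: Cinf_mul => //; exact: sg|exact: sg].
  by rewrite tan_mul //; [ring|exact: sg].
have -> : B j (fun y => f y *: Y y + Z y) = f x * B j Y + B j Z -
    V (lift ord0 j) x f * w x (dfwith (u j x) (z j) (Y x)).
  rewrite /B (bracket_linear _ sf sY sZ (sV _)).
  by rewrite mw multilinearD // multilinearZ //; ring.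
under eq_bigr do rewrite /C mw.
rewrite big_split /= -mulr_sumr /C; ring.
Qed.

Lemma koszul_linear V k f Y Z x : smoothV V -> Cinf f -> smooth_vfield Y ->
  smooth_vfield Z ->
  koszul w (dfwith V k (fun y => f y *: Y y + Z y)) x =
  f x * koszul w (dfwith V k Y) x + koszul w (dfwith V k Z) x.
Proof.
move=> sV sf sY sZ; pose t := tperm ord0 k.
have E H : smooth_vfield H -> koszul w (dfwith V k H) x =
    (-1) ^+ t * koszul w (dfwith (fun i => V (t i)) ord0 H) x.
  move=> sH; rewrite -koszul_perm; last by apply: smooth_dfwith => // i; exact: sV.
  congr (koszul w _ x); apply/esym/dfwith_eq; first by rewrite tpermR dfwithin.
  move=> i ik; rewrite dfwithout; first by rewrite /t tpermK.
  by rewrite -(tpermR ord0 k) (inj_eq perm_inj) eq_sym.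
rewrite !E //; last first.
  by apply: smooth_vfield_add => //; exact: smooth_vfield_mul.
by rewrite (koszul_linear0 x (fun i => sV (t i)) sf sY sZ) mulrDr mulrCA.
Qed.

(** The field may be expanded in a frame with coefficients that vanish at x. *)
Let koszul0 V k Z x : smoothV V -> smooth_vfield Z -> Z x = 0 ->
  koszul w (dfwith V k Z) x = 0.
Proof.
move=> sV sZ Zx0; have [c ac dx] := atlas_cover x.
have [chi [xi [E [[schi chi1] sxi sE spanE _]]]] := exists_frame ac dx.
have s0 : smooth_vfield (fun y : M => 0 : tangent y) by move=> f _; exact: Cinf_cst.
have k0 : koszul w (dfwith V k (fun y => 0)) x = 0.
  have E1 : (fun y : M => 1 *: (0 : tangent y) + 0) = (fun y => 0).
    by apply: vfield_eq => y; rewrite scale1r addr0.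
  have := koszul_linear k x sV (@Cinf_cst _ _ M 1) s0 s0.
  by rewrite E1 mul1r => /eqP; rewrite -subr_eq subrr eq_sym => /eqP.
have ksum (r : seq 'I_n) :
    koszul w (dfwith V k (fun y => \sum_(i <- r) Z y (xi i) *: E i y)) x = 0.
  elim: r => [|i r IH].
    by rewrite -[RHS]k0; congr (koszul w (dfwith V k _) x); apply: vfield_eq => y; rewrite big_nil.
  rewrite -[RHS](addr0 0) -{2}IH -(mul0r (koszul w (dfwith V k (E i)) x)).
  have <- : Z x (xi i) = 0 by rewrite Zx0.
  rewrite -(@koszul_linear _ _ (fun y => Z y (xi i))) //; last first.
  - apply: smooth_vfield_sum => j _; apply: smooth_vfield_mul => //; exact: sZ.
  - exact: sZ.
  by congr (koszul w (dfwith V k _) x); apply: vfield_eq => y; rewrite big_cons.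
have := koszul_linear k x sV schi sZ s0.
rewrite k0 addr0 (nbhs_singleton chi1) mul1r => <-.
rewrite -[RHS](ksum (index_enum _)); congr (koszul w (dfwith V k _) x).
by apply: vfield_eq => y; rewrite addr0 spanE.
Qed.

(** The fields are exchanged one at a time; at each step the difference of the
    old and the new field vanishes at x. *)
Lemma koszul_tensorial V W x : smoothV V -> smoothV W -> (forall i, V i x = W i x) ->
  koszul w V x = koszul w W x.
Proof.
move=> sV sW VW; pose mix m (i : 'I_p.+1) := if (i < m)%N then W i else V i.
have smix m : smoothV (mix m) by move=> i; rewrite /mix; case: ifP.
have mixV : mix 0%N = V by [].
have mixW : mix p.+1 = W by apply/funext => i; rewrite /mix ltn_ord.
suff H m : (m <= p.+1)%N -> koszul w (mix m) x = koszul w V x.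
  by rewrite -(H p.+1) // mixW.
elim: m => [//|m IH] mp; rewrite -IH 1?ltnW //.
pose k := Ordinal mp.
have -> : mix m.+1 = dfwith (mix m) k (W k).
  apply: dfwith_eq; first by rewrite /mix /= ltnSn.
  move=> j jk; rewrite /mix ltnS leq_eqVlt; have /negbTE -> // : (nat_of_ord j) != m.
  exact: jk.
have sd : smooth_vfield (fun y => (-1) *: V k y + W k y).
  by apply: smooth_vfield_add; [apply: smooth_vfield_mul; [exact: Cinf_cst|exact: sV]|exact: sW].
have := koszul_linear k x (smix m) (@Cinf_cst _ _ M 1) sd (sV k).
rewrite (koszul0 _ (smix m) sd) ?mulr0 ?add0r; last by rewrite VW scaleN1r addNr.
have -> : (fun y => 1 *: (-1 *: V k y + W k y) + V k y) = W k.
  by apply: vfield_eq => y; rewrite scale1r scaleN1r addrAC addNr add0r.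
move=> ->; congr (koszul w _ x); apply/esym/dfwith_eq => //.
by rewrite /mix ltnn.
Qed.

Lemma dformE V x : smoothV V -> dform w (fun i => V i x) = koszul w V x.
Proof.
move=> sV; apply: koszul_tensorial => // i; first exact: smooth_extend.
exact: extendE.
Qed.

Lemma dform_antisymmetric : antisymmetric_cochain (dform w).
Proof.
by move=> x v s; rewrite /dform -koszul_perm // => i; exact: smooth_extend.
Qed.

Lemma smooth_koszul V : smoothV V -> @Cinf R M (fun x => koszul w V x).
Proof.
move=> sV; apply: Cinf_add; apply: Cinf_sum => i _.
  apply: Cinf_mul; first exact: Cinf_cst.
  exact: (sV i _ (sw_lift i sV)).
apply: Cinf_sum => j ij; apply: Cinf_mul; first exact: Cinf_cst.
pose U k := if lift i k == j then bracket (V j) (V i) else V (lift i k).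
have sU k : smooth_vfield (U k) by rewrite /U; case: ifP => _ //; exact: smooth_bracket.
have := sw sU; congr (Cinf _); apply/funext => y; congr (w _ _).
by apply/funext => k; rewrite /U; case: ifP.
Qed.

Lemma Omega_dform : Omega M p.+1 (dform w).
Proof.
split.
- move=> x v i a u u'; set V := fun i => extend (v i).
  have sV : smoothV V by move=> j; exact: smooth_extend.
  have E H : smooth_vfield H ->
      dform w (dfwith v i (H x)) = koszul w (dfwith V i H) x.
    move=> sH; rewrite -dformE; last exact: smooth_dfwith.
    congr (dform w _); apply/esym/dfwith_eq; first by rewrite dfwithin.
    by move=> j ji; rewrite dfwithout 1?eq_sym // /V extendE.
  have [sU sU'] := (smooth_extend u, smooth_extend u').
  have := koszul_linear i x sV (@Cinf_cst _ _ M a) sU sU'.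
  rewrite -!E ?extendE //; apply: smooth_vfield_add => //.
  by apply: smooth_vfield_mul => //; exact: Cinf_cst.
- move=> x v i j ij vij.
  have := dform_antisymmetric v (tperm i j); rewrite odd_tperm ij expr1 mulN1r.
  have -> : (fun k => v (tperm i j k)) = v.
    by apply/funext => k; case: tpermP => // ->.
  by move=> /eqP; rewrite eq_sym -subr_eq0 -opprD oppr_eq0 -mulr2n mulrn_eq0 => /eqP.
- move=> V sV; under eq_fun do rewrite dformE //.
  exact: smooth_koszul.
Qed.

Lemma dform_scale a : dform (fun x v => a * w x v) = (fun x v => a * dform w v).
Proof.
apply: functional_extensionality_dep => x; apply/funext => v.
rewrite /dform /koszul mulrDr !mulr_sumr; congr (_ + _); apply: eq_bigr => i _.
  rewrite tan_scale; first by rewrite mulrCA.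
  apply: (@sw_lift (fun j => extend (v j)) i) => j; exact: smooth_extend.
by rewrite mulr_sumr; apply: eq_bigr => j _; rewrite mulrCA.
Qed.

End Koszul.

(** * Pull-back of forms *)

Lemma cochain_eq (R : realType) (S : smoothSpace R) p (w : cochain S p) (x y : S)
    (v : 'I_p -> tangent x) (u : 'I_p -> tangent y) : x = y ->
  (forall i f, Cinf f -> v i f = u i f) -> w x v = w y u.
Proof.
move=> xy; move: u; rewrite -xy => u vu; congr (w x _).
by apply/funext => i; apply: tangent_eq => f sf; exact: vu.
Qed.

Lemma cochain_ext (R : realType) (S : smoothSpace R) p (w w' : cochain S p) :
  (forall x v, w x v = w' x v) -> w = w'.
Proof. by move=> ww; apply: functional_extensionality_dep => x; apply/funext. Qed.

Lemma multilinear_sum (R : realType) (S : smoothSpace R) p (w : cochain S p) (x : S)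
    (v : 'I_p -> tangent x) i (I : Type) (r : seq I) (a : I -> R) (u : I -> tangent x) :
  multilinear w ->
  w x (dfwith v i (\sum_(j <- r) a j *: u j)) = \sum_(j <- r) a j * w x (dfwith v i (u j)).
Proof.
move=> mw; elim: r => [|j r IH]; first by rewrite !big_nil multilinear0.
by rewrite !big_cons multilinearD // multilinearZ // IH.
Qed.

Section Pullback.
Variables (R : realType) (n : nat) (M : manifold R n) (F : M -> M).
Hypothesis sF : smooth_map F.

Let pushF (x : M) (v : tangent x) g : Cinf g -> push F v g = v (g \o F).
Proof. by move=> sg; apply: pushE => //; exact: manifold_algebra. Qed.

Lemma push_linear (x : M) a (v u : tangent x) :
  push F (a *: v + u) = a *: push F v + push F u.
Proof.
by apply: tangent_eq => g sg; rewrite tangentD tangentZ !pushF.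
Qed.

Lemma push_dfwith p (x : M) (v : 'I_p -> tangent x) i u :
  (fun j => push F (dfwith v i u j)) = dfwith (fun j => push F (v j)) i (push F u).
Proof.
apply: dfwith_eq; first by rewrite dfwithin.
by move=> j ji; rewrite dfwithout // eq_sym.
Qed.

Lemma multilinear_pullback p (w : cochain M p) :
  multilinear w -> multilinear (pullback F w).
Proof.
by move=> mw x v i a u u'; rewrite /pullback !push_dfwith push_linear.
Qed.

Lemma alternating_pullback p (w : cochain M p) :
  alternating w -> alternating (pullback F w).
Proof. by move=> aw x v i j ij vij; apply: (aw _ _ i j) => //; rewrite vij. Qed.

Lemma koszul_pullback p (w : cochain M p) (V W : 'I_p.+1 -> vfield M) x :
  smooth_cochain w -> (forall i, smooth_vfield (V i)) ->
  (forall i, smooth_vfield (W i)) -> (forall i y, W i (F y) = push F (V i y)) ->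
  koszul (pullback F w) V x = koszul w W (F x).
Proof.
move=> sw sV sW VW.
have rel i (g : M -> R) : Cinf g -> (fun y => V i y (g \o F)) = (fun y => W i y g) \o F.
  by move=> sg; apply/funext => y /=; rewrite VW pushF.
rewrite /koszul; congr (_ + _); apply: eq_bigr => i _.
  congr (_ * _); have -> : (fun y => pullback F w (fun k => V (lift i k) y)) =
      (fun y => w y (fun k => W (lift i k) y)) \o F.
    by apply/funext => y; congr (w _ _); apply/funext => k; rewrite VW.
  rewrite VW pushF //; apply: (sw (fun k => W (lift i k))) => k; exact: sW.
apply: eq_bigr => j _; congr (_ * w _ _); apply/funext => k.
case: ifP => _; last by rewrite VW.
apply: tangent_eq => g sg; rewrite pushF // !bracketE //; last exact: sF.
by rewrite !VW !pushF ?(rel _ _ sg) //; exact: sW.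
Qed.

(** The extensions at x are pushed forward to extensions at F x: by tensoriality d
    may be computed with these. *)
Lemma dform_pullback p (w : cochain M p) (G : M -> M) : smooth_map G ->
  cancel F G -> cancel G F -> Omega M p w ->
  dform (pullback F w) = pullback F (dform w).
Proof.
move=> sG FK GK [mw aw sw]; apply: cochain_ext => x v.
have sE i := smooth_extend (v i).
pose D i y := fun g => extend (v i) (G y) (g \o F).
have derD i y : derivation_at y (D i y).
  split=> [a f g sf sg|f g sf sg].
    exact: (tan_lin _ a (sF sf) (sF sg)).
  have := tan_mul (extend (v i) (G y)) (sF sf) (sF sg).
  by rewrite /= GK.
pose W i y := mk_tangent y (D i y).
have WE i y g : Cinf g -> W i y g = D i y g.
  by move=> sg; apply: mk_tangentE => //; exact: manifold_algebra.
have sW i : smooth_vfield (W i).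
  move=> g sg; rewrite (_ : (fun y => _) = (fun y => extend (v i) y (g \o F)) \o G).
    exact: sG (sE i _ (sF sg)).
  by apply/funext => y; rewrite WE.
have VW i y : W i (F y) = push F (extend (v i) y).
  by apply: tangent_eq => g sg; rewrite WE // pushF // /D FK.
transitivity (koszul (pullback F w) (fun i => extend (v i)) x); first by [].
rewrite (koszul_pullback _ sw sE sW VW) -(dformE mw aw sw _ sW).
by congr (dform w _); apply/funext => i; rewrite VW extendE.
Qed.

End Pullback.

(** * The flow and the average of its pull-backs *)

Section FlowCalculus.
Variables (R : realType) (n : nat) (M : manifold R n).
Variables (X : vfield M) (phi : R -> M -> M).
Hypothesis flow : complete_flow X phi.
Notation mu := (@lebesgue_measure R).

Let Phi (q : line_space M) : M := phi q.2 q.1.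

Lemma smooth_flow : smooth_map Phi.
Proof. by case: flow. Qed.

Lemma flow0 m : phi 0 m = m.
Proof. by case: flow. Qed.

Lemma flowD s t m : phi (s + t) m = phi s (phi t m).
Proof. by case: flow. Qed.

Lemma flowK s : cancel (phi s) (phi (- s)).
Proof. by move=> m; rewrite -flowD addNr flow0. Qed.

Lemma flowVK s : cancel (phi (- s)) (phi s).
Proof. by move=> m; rewrite -flowD subrr flow0. Qed.

Lemma smooth_flow_at s : smooth_map (phi s : M -> M).
Proof. by move=> g sg; exact: Cinfl_slice s (smooth_flow sg). Qed.

Lemma push_flowE s (x : M) (v : tangent x) g : Cinf g ->
  push (phi s : M -> M) v g = v (g \o phi s).
Proof. by move=> sg; apply: pushE => //; [exact: manifold_algebra|exact: smooth_flow_at]. Qed.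

Lemma pullback_flow0 p (w : cochain M p) : pullback (phi 0) w = w.
Proof.
apply: cochain_ext => x v; apply: (@cochain_eq _ _ _ w (phi 0 x) x); first exact: flow0.
move=> i f sf; rewrite push_flowE //; congr (tanval _ _).
by apply/funext => y /=; rewrite flow0.
Qed.

Lemma pullback_flowD s t p (w : cochain M p) :
  pullback (phi (s + t)) w = pullback (phi t) (pullback (phi s) w).
Proof.
apply: cochain_ext => x v; apply: (@cochain_eq _ _ _ w (phi (s + t) x) (phi s (phi t x)));
  first exact: flowD.
move=> i f sf; rewrite !push_flowE //; last exact: smooth_flow_at.
by congr (tanval _ _); apply/funext => y /=; rewrite flowD.
Qed.

(** The pushed-forward fields are replaced by the members of a frame, one slot at
    a time; the coefficients are the derivatives along V_i of the coordinates
    composed with the flow, which are smooth in (x, s). *)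
Lemma smooth_pullback_flow p (w : cochain M p) (V : 'I_p -> vfield M) :
  Omega M p w -> (forall i, smooth_vfield (V i)) ->
  @Cinf _ (line_space M) (fun q => pullback (phi q.2) w (fun i => V i q.1)).
Proof.
move=> [mw _ sw] sV.
pose arg k (E : 'I_p -> vfield M) (q : M * R) (j : 'I_p) : tangent (Phi q) :=
  if (j < k)%N then push (phi q.2 : M -> M) (V j q.1) else E j (Phi q).
suff H k E : (k <= p)%N -> (forall i, smooth_vfield (E i)) ->
    @Cinf _ (line_space M) (fun q => w (Phi q) (arg k E q)).
  have := H p (fun i y => 0) (leqnn p) (fun i f _ => @Cinf_cst _ _ M 0).
  congr (Cinf _); apply/funext => q; congr (w _ _); apply/funext => j.
  by rewrite /arg ltn_ord.
elim: k E => [|k IH] E kp sE.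
  exact: smooth_flow (sw E sE).
apply: Cinfl_local => x s; pose y := phi s x.
have [c ac dy] := atlas_cover y.
have [chi [xi [e [[schi chi1] sxi se spanE _]]]] := exists_frame ac dy.
pose k0 := Ordinal kp.
exists (fun q => \sum_(i < n) V k0 q.1 (fun m => xi i (Phi (m, q.2))) *
    w (Phi q) (arg k (dfwith E k0 (e i)) q)).
  apply/CinflP => c' ac' l; apply: Cupto_sum; first exact: open_cimT.
  move=> i _; apply: Cupto_mul; first exact: open_cimT.
    by have /CinflP := Cinfl_vfield (sV k0) (smooth_flow (sxi i)); exact.
  have /CinflP : @Cinf _ (line_space M)
    (fun q => w (Phi q) (arg k (dfwith E k0 (e i)) q)); last exact.
  apply: IH; first exact: ltnW.
  move=> j; have [->|jk] := eqVneq j k0; first by rewrite dfwithin.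
  by rewrite dfwithout // eq_sym.
have [b sb [b1 b0]] := exists_bump chi1.
have near1 : \forall q \near ((x, s) : carrier M * R), chi (Phi q) = 1.
  have cb : continuous (b \o Phi : carrier M * R -> R).
    exact: Cinfl_continuous (smooth_flow sb).
  have : \forall q \near ((x, s) : carrier M * R), b (Phi q) != 0.
    apply: (cb (x, s) [set t | t != 0]); rewrite /= b1.
    by apply: open_nbhs_nbhs; split; [exact: open_neq|rewrite /= oner_eq0].
  apply: filterS => q /eqP bq; apply: contrapT => nq; apply: bq; exact: b0.
apply: filterS near1 => q chiq.
have uE (u : tangent (Phi q)) : u = \sum_(i < n) u (xi i) *: e i (Phi q).
  by rewrite -spanE chiq scale1r.
pose u : tangent (Phi q) := push (phi q.2 : M -> M) (V k0 q.1).
have -> : arg k.+1 E q = dfwith (arg k E q) k0 u.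
  apply: dfwith_eq; first by rewrite /arg /= ltnSn.
  move=> j jk; rewrite /arg ltnS leq_eqVlt; have /negbTE -> // : nat_of_ord j != k.
  exact: jk.
rewrite (uE u) multilinear_sum //; apply: eq_bigr => i _.
rewrite /u push_flowE //; congr (_ * w _ _); apply/esym/dfwith_eq.
  by rewrite /arg /= ltnn dfwithin.
by move=> j jk; rewrite /arg dfwithout // eq_sym.
Qed.

Lemma Omega_pullback_flow s p (w : cochain M p) : Omega M p w ->
  Omega M p (pullback (phi s) w).
Proof.
move=> Ow; have [mw aw _] := Ow; split.
- exact: (multilinear_pullback (@smooth_flow_at s)).
- exact: alternating_pullback.
- by move=> V sV; exact: Cinfl_slice s (smooth_pullback_flow Ow sV).
Qed.

Lemma pullback_flow_curve p (w : cochain M p) (x : M) (v : 'I_p -> tangent x) k :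
  Omega M p w -> Cupto k setT (fun s => pullback (phi s) w v).
Proof.
move=> Ow; have sV i := smooth_extend (v i).
have := Cinfl_curve x k (smooth_pullback_flow Ow sV).
congr (Cupto _ _ _); apply/funext => s /=; congr (pullback _ _ _).
by apply/funext => i; rewrite extendE.
Qed.

Lemma pullback_flow_continuous p (w : cochain M p) (x : M) (v : 'I_p -> tangent x) :
  Omega M p w -> continuous (fun s => pullback (phi s) w v).
Proof. by move=> Ow s; exact: (Cupto_cont (pullback_flow_curve v 0 Ow)). Qed.

(** Up to the sign (-1)^p, this is the operator I on p-forms. *)
Definition flow_average p (w : cochain M p) : cochain M p :=
  fun x v => \int[mu]_(s in `[0, 1]) pullback (phi s) w v.

Lemma Omega_flow_average p (w : cochain M p) : Omega M p w ->
  Omega M p (flow_average w).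
Proof.
move=> Ow; have O s := Omega_pullback_flow s Ow; split.
- move=> x v i a u u'; rewrite /flow_average.
  under eq_Rintegral do rewrite (let: And3 m _ _ := O _ in m).
  rewrite RintegralD //.
  + rewrite RintegralZl //; apply: integrable01; exact: pullback_flow_continuous.
  + apply: integrable01 => s; apply: cvgMl_tmp; exact: pullback_flow_continuous.
  + apply: integrable01; exact: pullback_flow_continuous.
- move=> x v i j ij vij; rewrite /flow_average.
  under eq_Rintegral do rewrite (let: And3 _ al _ := O _ in al _ _ i j ij vij).
  by rewrite Rintegral_cst // mul0r.
- by move=> V sV; exact: Cinf_Rintegral (smooth_pullback_flow Ow sV).
Qed.

(** The vector fields may be moved under the integral sign, and d commutes with
    each pull-back. *)
Lemma dform_flow_average p (w : cochain M p) : Omega M p w ->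
  dform (flow_average w) = flow_average (dform w).
Proof.
move=> Ow; apply: cochain_ext => x v.
have dE s : pullback (phi s) (dform w) = dform (pullback (phi s) w).
  rewrite (@dform_pullback _ _ _ _ (@smooth_flow_at s) _ w (phi (- s))) //.
  - exact: smooth_flow_at.
  - exact: flowK.
  - exact: flowVK.
rewrite /flow_average; under [RHS]eq_Rintegral do rewrite dE.
have sV i := smooth_extend (v i); set V := fun i => extend (v i).
have {}sV i : smooth_vfield (V i) by exact: sV.
pose a i (s : R) := V i x (fun y => pullback (phi s) w (fun k => V (lift i k) y)).
pose b (i j : 'I_p.+1) (s : R) := pullback (phi s) w (fun k =>
  if lift j k == i then bracket (V i) (V j) x else V (lift j k) x).
have ca i : continuous (a i).
  apply: (tangent_curve_continuous (F := fun q => pullback (phi q.2) w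
    (fun k => V (lift i k) q.1))).
  by apply: (smooth_pullback_flow (V := fun k => V (lift i k)) Ow) => k; exact: sV.
have cb i j : continuous (b i j) by exact: pullback_flow_continuous.
have -> : dform (fun y v => \int[mu]_(s in `[0, 1]) pullback (phi s) w v) v =
    \sum_(i < p.+1) (-1) ^+ i * \int[mu]_(s in `[0, 1]) a i s +
    \sum_(j < p.+1) \sum_(i < p.+1 | (i < j)%N)
      (-1) ^+ j * \int[mu]_(s in `[0, 1]) b i j s.
  rewrite /dform /koszul; congr (_ + _); apply: eq_bigr => i _; congr (_ * _).
  rewrite -/(V i) (@tangent_Rintegral _ _ _ (fun q => pullback (phi q.2) w
    (fun k => V (lift i k) q.1))) //.
  by apply: (smooth_pullback_flow (V := fun k => V (lift i k)) Ow) => k; exact: sV.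
(* The double sum is written as a sum over pairs, to which linearity of the
   integral applies at once. *)
have -> : (fun s => dform (pullback (phi s) w) v) = (fun s =>
    \sum_(i < p.+1) (-1) ^+ i * a i s + \sum_(ij <- [seq ij : 'I_p.+1 * 'I_p.+1 <-
      index_enum _ | (ij.1 < ij.2)%N]) (-1) ^+ ij.2 * b ij.1 ij.2 s).
  apply/funext => s; rewrite /dform /koszul; congr (_ + _).
  by rewrite (exchange_big_dep xpredT) //= pair_big_dep big_filter.
rewrite RintegralD //; last 2 first.
- by apply: integrable01; exact: continuous_lincomb.
- by apply: integrable01; exact: (continuous_lincomb (f := fun ij => b ij.1 ij.2)).
rewrite (Rintegral01_lincomb _ _ ca).
rewrite (@Rintegral01_lincomb _ _ _
  (fun ij : 'I_p.+1 * 'I_p.+1 => (-1) ^+ ij.2) (fun ij => b ij.1 ij.2)); last by move=> ij; exact: cb.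
congr (_ + _).
by rewrite big_filter (exchange_big_dep xpredT) //= pair_big_dep.
Qed.

(** By the group law of the flow, the derivative at 0 defining L_X becomes the
    derivative at s. *)
Lemma lie_curve p (w : cochain M p) s (x : M) (v : 'I_p -> tangent x) :
  pullback (phi s) (lie phi w) v = derive1 (fun t => pullback (phi t) w v) s.
Proof.
rewrite {1}/pullback /lie.
have -> : (fun t => pullback (phi t) w (fun i => push (phi s : M -> M) (v i))) =
    (fun t => pullback (phi (t + s)) w v).
  by apply/funext => t; rewrite pullback_flowD.
by rewrite /derive1; under eq_fun do rewrite addr0 add0r.
Qed.

Lemma lie_curve_continuous p (w : cochain M p) (x : M) (v : 'I_p -> tangent x) :
  Omega M p w -> continuous (fun s => pullback (phi s) (lie phi w) v).
Proof.
move=> Ow; under eq_fun do rewrite lie_curve derive1E.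
have cD := Cupto_derive (1 : R) (pullback_flow_curve v 1 Ow).
move=> s; have cDs : {for s, continuous ('D_1 (fun t => pullback (phi t) w v))}.
  exact: Cupto_cont cD _.
exact: cDs.
Qed.

(** The fundamental theorem of calculus along the flow line. *)
Lemma flow_average_lie p (w : cochain M p) : Omega M p w ->
  flow_average (lie phi w) = fun x v => pullback (phi 1) w v - w x v.
Proof.
move=> Ow; apply: cochain_ext => x v.
have dw s : is_derive s (1 : R) (fun s => pullback (phi s) w v)
    (pullback (phi s) (lie phi w) v).
  rewrite lie_curve derive1E.
  exact: Cupto_is_derive (pullback_flow_curve v 1 Ow) _.
by rewrite /flow_average (FTC01 dw) ?pullback_flow0 //; exact: lie_curve_continuous.
Qed.

Lemma lie_antisymmetric p (w : cochain M p) : Omega M p w ->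
  antisymmetric_cochain (lie phi w).
Proof.
move=> Ow x v s; rewrite /lie !derive1E.
have df : is_derive (0 : R) 1 (fun t => pullback (phi t) w v)
    ('D_1 (fun t => pullback (phi t) w v) 0).
  exact: Cupto_is_derive (pullback_flow_curve v 1 Ow) _.
have -> : (fun t => pullback (phi t) w (fun i => v (s i))) =
    (fun t => (-1) ^+ s * pullback (phi t) w v).
  apply/funext => t; have [mw aw _] := Omega_pullback_flow t Ow.
  exact: (alternating_antisymmetric mw aw).
by have [_ ->] := is_deriveZ ((-1) ^+ s : R) df.
Qed.

(** The support is moved by the homeomorphism phi_(-s). *)
Lemma Omega_c_pullback_flow s p (w : cochain M p) : @Omega_c R n M p w ->
  @Omega_c R n M p (pullback (phi s) w).
Proof.
move=> [Ow cw]; split; first exact: Omega_pullback_flow.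
set K := closure _ in cw.
have cK : compact ((phi (- s) : carrier M -> carrier M) @` K).
  apply: continuous_compact => //; apply: continuous_subspaceT.
  exact: (smooth_map_continuous (@smooth_flow_at (- s))).
have sub : [set x : carrier M | exists v, pullback (phi s) w (x := x) v != 0] `<=`
    (phi (- s) : carrier M -> carrier M) @` K.
  move=> x [v wv]; exists (phi s x); last exact: flowK.
  by apply: subset_closure; exists (fun i => push (phi s : M -> M) (v i)).
apply: (subclosed_compact _ cK); first exact: closed_closure.
have clK := compact_closed (manifold_hausdorff (m := M)) cK.
by rewrite ((closure_id _).1 clK); exact: closureS.
Qed.

End FlowCalculus.

(** * Contraction of a wedge product *)

Lemma odd_cast_perm m n (e : m = n) (s : 'S_m) : cast_perm e s = s :> bool.
Proof. by subst m; rewrite cast_perm_id. Qed.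

Lemma sum_lift_perm (R : nmodType) p (i j : 'I_p.+1) (G : 'S_p.+1 -> R) :
  \sum_(s : 'S_p.+1 | s i == j) G s = \sum_(t : 'S_p) G (lift_perm i j t).
Proof.
have inj : injective (lift_perm i j : 'S_p -> 'S_p.+1).
  move=> t t' /permP E; apply/permP => k; apply: (@lift_inj _ j).
  by rewrite -!(lift_perm_lift i).
rewrite (reindex (lift_perm i j)) /=; last first.
  exists (fun s => odflt 1%g [pick t | lift_perm i j t == s]).
    move=> t _; case: pickP => [t' /eqP/inj //|/(_ t)]; by rewrite eqxx.
  move=> s; rewrite inE => /eqP sij; case: pickP => [t /eqP //|].
  have [t st _] := perm_lift s i; move=> /(_ t)/eqP[]; apply/permP => k.
  case: (unliftP i k) => [l ->|->]; last by rewrite lift_perm_id.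
  by rewrite lift_perm_lift -sij st.
by apply: eq_bigl => t; rewrite lift_perm_id eqxx.
Qed.

(** Only the permutations that send the last index to the first one contribute,
    since B sees no other argument; there are p! of them, and by antisymmetry
    each contributes the same term. *)
Lemma wedge_contract (R : realType) (S : smoothSpace R) p (A : cochain S p)
    (B : cochain S 1) (x : S) (u : 'I_p.+1 -> tangent x) :
  antisymmetric_cochain A ->
  (forall j, B x (fun=> u (lift ord0 j)) = 0) -> B x (fun=> u ord0) = 1 ->
  cast_cochain (addn1 p) (wedge A B) u = (-1) ^+ p * A x (fun j => u (lift ord0 j)).
Proof.
move=> aA B0 B1; rewrite /cast_cochain /wedge.
rewrite (reindex (cast_perm (esym (addn1 p)))) /=; last first.
  apply: onW_bij; exists (cast_perm (addn1 p)); [exact: cast_permKV|exact: cast_permK].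
have castl (s : 'S_p.+1) i :
    cast_ord (addn1 p) (cast_perm (esym (addn1 p)) s (lshift 1 i)) = s (lift ord_max i).
  rewrite cast_permE cast_ordKV; congr (s _); apply: val_inj => /=.
  by rewrite /bump leqNgt ltn_ord.
have castr (s : 'S_p.+1) (j : 'I_1) :
    cast_ord (addn1 p) (cast_perm (esym (addn1 p)) s (rshift p j)) = s ord_max.
  rewrite cast_permE cast_ordKV; congr (s _); apply: val_inj => /=.
  by rewrite [j]ord1 addn0.
rewrite (bigID (fun s : 'S_p.+1 => s ord_max == ord0)) /= [X in _ + X]big1 ?addr0; last first.
  move=> s nz; have -> : (fun j => u (cast_ord (addn1 p)
      (cast_perm (esym (addn1 p)) s (rshift p j)))) = (fun=> u (s ord_max)).
    by apply/funext => j; rewrite castr.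
  by case: (unliftP ord0 (s ord_max)) nz => [j ->|->]; rewrite ?B0 ?mulr0.
rewrite sum_lift_perm.
rewrite (eq_bigr (fun=> (-1) ^+ p * A x (fun j => u (lift ord0 j)))); last first.
  move=> t _.
  rewrite odd_cast_perm odd_lift_perm addbF.
  have -> : (fun j : 'I_1 => u (cast_ord (addn1 p)
      (cast_perm (esym (addn1 p)) (lift_perm ord_max ord0 t) (rshift p j)))) =
      (fun=> u ord0).
    by apply/funext => j; rewrite castr lift_perm_id.
  rewrite B1 mulr1.
  have -> : (fun i => u (cast_ord (addn1 p)
      (cast_perm (esym (addn1 p)) (lift_perm ord_max ord0 t) (lshift 1 i)))) =
      (fun i => (fun j => u (lift ord0 j)) (t i)).
    by apply/funext => i; rewrite castl lift_perm_lift.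
  rewrite (aA x (fun j => u (lift ord0 j)) t) mulrA signr_addb signr_odd.
  by rewrite -[X in X * _]mulrA -signr_addb addbb mulr1.
rewrite sumr_const card_Sn -[X in _ * X]mulr_natl muln1 mulKf //.
Qed.

(** * The cylinder *)

Section Cylinder.
Variables (R : realType) (n : nat) (M : manifold R n).
Notation mu := (@lebesgue_measure R).
Notation I := (I01 R).

Lemma cyl_algebra : Cinf_algebra (cyl_space M).
Proof.
split=> [a f g [F sF fF] [G sG gG]|f g [F sF fF] [G sG gG]].
  exists (fun q => a * F q + G q); last by move=> m s; rewrite fF gG.
  by apply: Cinfl_add => //; apply: Cinfl_mul => //; exact: Cinfl_cst.
exists (fun q => F q * G q); last by move=> m s; rewrite fF gG.
exact: Cinfl_mul.
Qed.

Lemma I01_algebra : Cinf_algebra (@I01_space R).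
Proof.
have oT := @openT R.
split=> [a f g [F /smooth_onE sF fF] [G /smooth_onE sG gG]
        |f g [F /smooth_onE sF fF] [G /smooth_onE sG gG]].
  exists (fun s => a * F s + G s); last by move=> s; rewrite fF gG.
  apply/smooth_onE => k; apply: Cupto_add => //.
  by apply: Cupto_mul => //; exact: Cupto_cst.
exists (fun s => F s * G s); last by move=> s; rewrite fF gG.
by apply/smooth_onE => k; apply: Cupto_mul.
Qed.

Lemma Cinf_val : @Cinf R (@I01_space R) val.
Proof.
exists id => //; apply/smooth_onE => k.
by apply: Cupto_linear => [|s|//]; [exact: openT|exact: cvg_id].
Qed.

Lemma smooth_iota (s : I) : smooth_map (iota s : M -> cyl_space M).
Proof.
move=> f [F sF fF]; rewrite (_ : f \o iota s = fun m => F (m, val s)).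
  exact: Cinfl_slice.
by apply/funext => m; rewrite /iota /= fF.
Qed.

Lemma smooth_pr2 : smooth_map (@pr2 R n M).
Proof.
move=> f [g /smooth_onE sg fg]; exists (fun q => g q.2); last first.
  by move=> m s; rewrite /pr2 /= fg.
apply/CinflP => c ac k.
apply: (@Cupto_affine _ _ _ _ _ setT g snd snd) (sg k); [exact: open_cimT|exact: openT|..] => //.
by move=> x _; exact: cvg_snd.
Qed.

(** [0,1] has no isolated point. *)
Lemma dnbhs_I01_proper (s : I) : ProperFilter s^'.
Proof.
apply: Build_ProperFilter => //; rewrite /dnbhs => H.
have : nbhs s (fun t => t = s).
  by move: H; rewrite /within /=; apply: filterS => t nt; apply: contrapT => /eqP/nt.
move=> [_ /= [[W oW <-] /= Ws WE]].
have /nbhs_ballP[e /= e0 eW] : nbhs (val s) W by exact: open_nbhs_nbhs.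
have [s0 s1] : 0 <= val s /\ val s <= 1.
  by have := set_valP s; rewrite /= in_itv /= => /andP[].
have key (t : R) : 0 <= t -> t <= 1 -> `|val s - t| < e -> t = val s.
  move=> t0 t1 te; have tI : t \in (`[0 : R, 1 : R]%classic).
    by rewrite inE /= in_itv /= t0 t1.
  by rewrite -(WE (SigSub tI)) //; apply: eW; rewrite -ball_normE.
have [s12|s12] := leP (val s) (1 / 2).
  pose d := Num.min (e / 2) (1 / 2).
  have d0 : 0 < d by rewrite lt_min; apply/andP; split; lra.
  have d2 : d <= 1 / 2 by rewrite ge_min lexx orbT.
  have de : d < e by rewrite gt_min; apply/orP; left; lra.
  have := key (val s + d); rewrite opprD addNKr normrN gtr0_norm // => /(_ _ _ de) E.
  have : val s + d = val s by apply: E; lra.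
  by lra.
pose d := Num.min (e / 2) (1 / 2).
have d0 : 0 < d by rewrite lt_min; apply/andP; split; lra.
have d2 : d <= 1 / 2 by rewrite ge_min lexx orbT.
have de : d < e by rewrite gt_min; apply/orP; left; lra.
have := key (val s - d); rewrite opprB addrCA subrr addr0 gtr0_norm // => /(_ _ _ de) E.
have : val s - d = val s by apply: E; lra.
by lra.
Qed.

(** The limit along s^' is taken in [0,1], hence one-sided at the end points; since
    g is differentiable there, it is the two-sided derivative. *)
Lemma cvg_ddS (g : R -> R) (s : I) : derivable g (val s) 1 ->
  (g (val t) - g (val s)) / (val t - val s) @[t --> s^'] --> 'D_1 g (val s).
Proof.
move=> dg; pose h (t : I) := val t - val s.
have cval : val t @[t --> s] --> val s by exact: initial_continuous.
have ch : h t @[t --> s^'] --> (0 : R)^'.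
  move=> A [e /= e0 eA]; move/cvgrPdist_lt : cval => /(_ e e0).
  rewrite /dnbhs; apply: filterS => t te ts; apply: eA.
    by rewrite /= sub0r normrN /h distrC.
  by rewrite /h subr_eq0; apply: contra_neq ts => /val_inj.
have := cvg_comp _ _ ch dg; apply: cvg_trans; apply: near_eq_cvg.
by apply: nearW => t; rewrite /= /h /GRing.scale /= mulr1 subrK mulrC.
Qed.

Lemma ddSE (f : cyl_space M -> R) (F : line_space M -> R) m (s : I) :
  Cinf F -> (forall m s, f (m, s) = F (m, val s)) ->
  ddS ((m, s) : cyl_space M) f = 'D_1 (fun t => F (m, t)) (val s).
Proof.
move=> sF fF.
have dF (G : line_space M -> R) t : Cinf G -> is_derive t (1 : R) (fun t => G (m, t))
    ('D_1 (fun t => G (m, t)) t).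
  by move=> sG; exact: (Cupto_is_derive (1 : R) (Cinfl_curve m 1 sG) Logic.I).
pose D (f : cyl_space M -> R) := lim ((f (m, t) - f (m, s)) / (val t - val s) @[t --> s^']).
have DE (g : cyl_space M -> R) (G : line_space M -> R) : Cinf G ->
    (forall m s, g (m, s) = G (m, val s)) -> D g = 'D_1 (fun t => G (m, t)) (val s).
  move=> sG gG; have pf := dnbhs_I01_proper s; apply: cvg_lim => //.
  under eq_fun do rewrite !gG.
  by apply: (@cvg_ddS (fun t => G (m, t))); case: (dF G (val s) sG).
have algL a G H : Cinf G -> Cinf H -> @Cinf _ (line_space M) (fun q => a * G q + H q).
  by move=> sG sH; apply: Cinfl_add => //; apply: Cinfl_mul => //; exact: Cinfl_cst.
have derD : derivation_at ((m, s) : cyl_space M) D.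
  split=> [a g h [G sG gG] [H sH hH]|g h [G sG gG] [H sH hH]].
    rewrite (DE _ _ sG gG) (DE _ _ sH hH) (DE _ _ (algL a G H sG sH)).
      have [_ ->] := is_deriveD (is_deriveZ a (dF G (val s) sG)) (dF H (val s) sH).
      by [].
    by move=> m' s'; rewrite gG hH.
  rewrite (DE _ _ sG gG) (DE _ _ sH hH) (DE _ _ (Cinfl_mul sG sH)).
    have [_ ->] := is_deriveM (dF G (val s) sG) (dF H (val s) sH).
    by rewrite /GRing.scale /= gG hH; ring.
  by move=> m' s'; rewrite gG hH.
rewrite /ddS mk_tangentE; [exact: DE|exact: cyl_algebra|exact: derD|by exists F].
Qed.

Lemma to_I01K (s : R) : s \in `[0, 1]%classic -> val (to_I01 s) = s.
Proof. by move=> s01; rewrite /to_I01 insubdK. Qed.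

Section FibreIntegral.
Variables (X : vfield M) (phi : R -> M -> M).
Hypothesis flow : complete_flow X phi.

Lemma smooth_cyl_flow : smooth_map (cyl_flow phi).
Proof.
move=> f sf; exists (fun q : line_space M => f (phi q.2 q.1)); last by [].
exact: (smooth_flow flow sf).
Qed.

Lemma push_cyl_flow_iota (s : I) m (v : tangent m) :
  push (cyl_flow phi) (push (iota s : M -> cyl_space M) v) = push (phi (val s) : M -> M) v.
Proof.
apply: tangent_eq => f sf.
rewrite pushE //; [|exact: manifold_algebra|exact: smooth_cyl_flow].
rewrite pushE; [|exact: cyl_algebra|exact: smooth_iota|exact: smooth_cyl_flow sf].
rewrite pushE //; first exact: manifold_algebra.
exact: (smooth_flow_at flow _).
Qed.

Lemma Iop_integrand p (w : cochain M p) (s : I) m (v : 'I_p -> tangent m) :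
  antisymmetric_cochain w ->
  pullback (iota s) (interior (@ddS R n M) (cast_cochain (addn1 p)
    (wedge (pullback (cyl_flow phi) w) (pullback (@pr2 R n M) (@ds R))))) v =
  (-1) ^+ p * pullback (phi (val s)) w v.
Proof.
move=> aw.
pose u (i : 'I_p.+1) : tangent ((m, s) : cyl_space M) :=
  if unlift ord0 i is Some j then push (iota s : M -> cyl_space M) (v j)
  else ddS ((m, s) : cyl_space M).
have uj j : u (lift ord0 j) = push (iota s : M -> cyl_space M) (v j).
  by rewrite /u liftK.
have u0 : u ord0 = ddS ((m, s) : cyl_space M) by rewrite /u unlift_none.
have sval2 : @Cinf R (cyl_space M) (fun q => val q.2).
  exact: (smooth_pr2 Cinf_val).
have dsE (b : tangent ((m, s) : cyl_space M)) :
    pullback (@pr2 R n M) (@ds R) (fun=> b) = b (fun q => val q.2).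
  by rewrite /pullback /ds pushE; [|exact: I01_algebra|exact: smooth_pr2|exact: Cinf_val].
transitivity (cast_cochain (addn1 p) (wedge (pullback (cyl_flow phi) w)
    (pullback (@pr2 R n M) (@ds R))) u); first by [].
rewrite (@wedge_contract R (cyl_space M) p (pullback (cyl_flow phi) w)
  (pullback (@pr2 R n M) (@ds R)) (m, s) u).
- congr (_ * w _ _); apply/funext => j; rewrite uj.
  exact: push_cyl_flow_iota.
- by move=> x u' t; exact: aw.
- move=> j; rewrite dsE uj pushE //; [|exact: cyl_algebra|exact: smooth_iota].
  exact: tan_cst.
- rewrite dsE u0 (@ddSE _ (fun q => q.2)) //.
    exact: derive_id.
  apply/CinflP => c ac k; apply: Cupto_linear => //; first exact: open_cimT.
  by move=> q; exact: cvg_snd.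
Qed.

(** The cochains to which the explicit formula for I applies. *)
Definition flow_regular p (w : cochain M p) := antisymmetric_cochain w /\
  forall m (v : 'I_p -> tangent m), continuous (fun s => pullback (phi s) w v).

Lemma Omega_flow_regular p (w : cochain M p) : Omega M p w -> flow_regular w.
Proof.
move=> Ow; have [mw aw _] := Ow; split; first exact: alternating_antisymmetric.
by move=> m v; exact: (pullback_flow_continuous flow Ow).
Qed.

Lemma lie_flow_regular p (w : cochain M p) : Omega M p w -> flow_regular (lie phi w).
Proof.
move=> Ow; split; first exact: (lie_antisymmetric flow Ow).
by move=> m v; exact: (lie_curve_continuous flow Ow).
Qed.

(** The integrand of I at s is the contraction with d/ds of phi^* eta /\ ds,
    evaluated on vectors tangent to the slice M x {s}, on which ds vanishes. *)
Lemma IopE (eta : gcochain M) p : flow_regular (eta p) ->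
  @Iop R n M phi eta p = (fun m v => (-1) ^+ p * flow_average phi (eta p) v).
Proof.
move=> [aw cw]; apply: cochain_ext => m v.
rewrite /Iop /fibint /flow_average -RintegralZl //; last exact: integrable01.
by apply: eq_Rintegral => s s01; rewrite Iop_integrand // to_I01K.
Qed.

Lemma flow_regular_sum p (J : Type) (r : seq J) (a : J -> R) (u : J -> cochain M p) :
  (forall j, flow_regular (u j)) ->
  flow_regular (fun m v => \sum_(j <- r) a j * u j m v).
Proof.
move=> ru; split=> [m v s|m v].
  rewrite mulr_sumr; apply: eq_bigr => j _; have [aj _] := ru j.
  by rewrite aj mulrCA.
apply: (continuous_lincomb (f := fun j s => pullback (phi s) (u j) v)) => j.
by have [_] := ru j.
Qed.

Lemma flow_average_sum p (J : Type) (r : seq J) (a : J -> R) (u : J -> cochain M p) m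
    (v : 'I_p -> tangent m) : (forall j, flow_regular (u j)) ->
  flow_average phi (fun m v => \sum_(j <- r) a j * u j m v) v =
  \sum_(j <- r) a j * flow_average phi (u j) v.
Proof.
move=> ru; apply: (@Rintegral01_lincomb _ _ r a (fun j s => pullback (phi s) (u j) v)) => j.
by have [_] := ru j.
Qed.

End FibreIntegral.

End Cylinder.

(** * Spans of cochains *)

Section Spans.
Variables (R : realType) (S : smoothSpace R) (p : nat) (A : set (cochain S p)).

Lemma span_cochain0 : span_cochain A (fun x v => 0).
Proof.
exists 0%N, (fun=> 0), (fun _ x v => 0); split; first by case.
by apply: cochain_ext => x v; rewrite big_ord0.
Qed.

Lemma span_cochain_gen w : A w -> span_cochain A w.
Proof.
move=> Aw; exists 1%N, (fun=> 1), (fun=> w); split=> //.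
by apply: cochain_ext => x v; rewrite big_ord1 mul1r.
Qed.

Lemma span_cochain_lin a w w' : span_cochain A w -> span_cochain A w' ->
  span_cochain A (fun x v => a * w x v + w' x v).
Proof.
move=> [k [b [u [Au ->]]]] [k' [b' [u' [Au' ->]]]].
exists (k + k')%N, (fun i => match fintype.split i with inl j => a * b j | inr j => b' j end),
  (fun i => match fintype.split i with inl j => u j | inr j => u' j end).
split; first by move=> i; case: (fintype.split i).
apply: cochain_ext => x v; rewrite big_split_ord /= mulr_sumr; congr (_ + _).
  apply: eq_bigr => i _; have -> := unsplitK (inl i : 'I_k + 'I_k').
  by rewrite mulrA.
by apply: eq_bigr => i _; have -> := unsplitK (inr i : 'I_k + 'I_k').
Qed.

Lemma span_cochain_sum (I : Type) (r : seq I) (a : I -> R) (u : I -> cochain S p) :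
  (forall i, span_cochain A (u i)) ->
  span_cochain A (fun x v => \sum_(i <- r) a i * u i x v).
Proof.
move=> Au; elim: r => [|i r IH].
  have -> : (fun (x : S) (v : 'I_p -> tangent x) => \sum_(i <- [::]) a i * u i x v)
      = (fun x v => 0) by apply: cochain_ext => x v; rewrite big_nil.
  exact: span_cochain0.
have -> : (fun (x : S) (v : 'I_p -> tangent x) => \sum_(j <- i :: r) a j * u j x v) =
    (fun x v => a i * u i x v + \sum_(j <- r) a j * u j x v).
  by apply: cochain_ext => x v; rewrite big_cons.
exact: span_cochain_lin.
Qed.

Lemma span_cochain_scale a w : span_cochain A w ->
  span_cochain A (fun x v => a * w x v).
Proof.
move=> Aw; have := span_cochain_lin a Aw span_cochain0.
by congr (span_cochain A _); apply: cochain_ext => x v; rewrite addr0.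
Qed.

End Spans.

(** * The proposition *)

Lemma Omega_lin (R : realType) (n : nat) (M : manifold R n) p a (w w' : cochain M p) :
  Omega M p w -> Omega M p w' -> Omega M p (fun x v => a * w x v + w' x v).
Proof.
move=> [mw aw sw] [mw' aw' sw']; split.
- by move=> x v i b u u'; rewrite mw mw'; ring.
- by move=> x v i j ij vij; rewrite (aw _ _ _ _ ij vij) (aw' _ _ _ _ ij vij); ring.
- move=> V sV; apply: Cinf_add; last exact: sw'.
  by apply: Cinf_mul; [exact: Cinf_cst|exact: sw].
Qed.

Lemma Omega0 (R : realType) (n : nat) (M : manifold R n) p :
  Omega M p (fun x v => 0).
Proof.
split=> [x v i b u u'|x v i j _ _|V _]; rewrite ?mulr0 ?addr0 //.
exact: Cinf_cst.
Qed.

Section Proposition.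
Variables (R : realType) (n : nat) (M : manifold R n).
Variables (X : vfield M) (phi : R -> M -> M).
Hypothesis flow : complete_flow X phi.

Let Omega_scale p c (w : cochain M p) : Omega M p w -> Omega M p (fun x v => c * w x v).
Proof.
move=> Ow; have := Omega_lin c Ow (@Omega0 R n M p).
by congr (Omega M p _); apply: cochain_ext => x v; rewrite addr0.
Qed.

Let flow_average0 p : flow_average phi (fun (x : M) (v : 'I_p -> tangent x) => 0) =
  (fun x v => 0).
Proof. by apply: cochain_ext => x v; rewrite /flow_average Rintegral_cst // mul0r. Qed.

Let IopO (eta : gcochain M) p : Omega M p (eta p) ->
  @Iop R n M phi eta p = (fun m v => (-1) ^+ p * flow_average phi (eta p) v).
Proof. by move=> Ow; apply: (IopE flow); exact: (Omega_flow_regular flow). Qed.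

Let Iop0 (eta : gcochain M) p : eta p = (fun x v => 0) ->
  @Iop R n M phi eta p = (fun x v => 0).
Proof.
move=> e0; rewrite IopO ?e0; last exact: Omega0.
by apply: cochain_ext => x v; rewrite flow_average0 mulr0.
Qed.

Lemma Iop_Omega eta : gsum (Omega M) eta -> gsum (Omega M) (Iop phi eta).
Proof.
move=> [Oe [N eN]]; split=> [p|]; last by exists N => p /eN; exact: Iop0.
rewrite IopO //; apply: Omega_scale; exact: (Omega_flow_average flow).
Qed.

Lemma Iop_linear a eta eta' : gsum (Omega M) eta -> gsum (Omega M) eta' ->
  Iop phi (glin a eta eta') = glin a (Iop phi eta) (Iop phi eta').
Proof.
move=> [Oe _] [Oe' _]; apply: functional_extensionality_dep => p.
rewrite /glin !IopO //; last exact: Omega_lin.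
apply: cochain_ext => x v.
have [_ ce] := Omega_flow_regular flow (Oe p).
have [_ ce'] := Omega_flow_regular flow (Oe' p).
have -> : flow_average phi (fun x v => a * eta p x v + eta' p x v) v =
    a * flow_average phi (eta p) v + flow_average phi (eta' p) v.
  rewrite /flow_average -RintegralZl //; last exact: integrable01.
  rewrite -RintegralD //; [|exact: integrable01].
  by apply: integrable01 => s; apply: cvgMl_tmp; exact: ce.
by ring.
Qed.

Lemma Iop_d eta : gsum (Omega M) eta -> Iop phi (gd eta) = gopp (gd (Iop phi eta)).
Proof.
move=> [Oe _]; apply: functional_extensionality_dep => -[|p].
  by rewrite (Iop0 (p := 0%N)) //; apply: cochain_ext => x v; rewrite /gopp oppr0.
have [mw aw sw] := Oe p.
rewrite /gopp /= IopO /=; last exact: Omega_dform.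
have [mw' aw' sw'] := Omega_flow_average flow (Oe p).
apply: cochain_ext => x v; rewrite IopO // dform_scale //.
by rewrite (dform_flow_average flow (Oe p)) exprS mulN1r mulNr.
Qed.

Let lie_span p := span_cochain [set lie phi w | w in @Omega_c R n M p].
Let coinv_span p := span_cochain
    [set u | exists (k : int) (w : cochain M p), @Omega_c R n M p w /\
       u = (fun m v => w m v - pullback (rho phi k) w v)].
Arguments lie_span : clear implicits.
Arguments coinv_span : clear implicits.

Let lie_span_regular p w : lie_span p w -> flow_regular phi w.
Proof.
move=> [k [a [u [Lu ->]]]]; apply: flow_regular_sum => i.
by have [w' [Ow' _] <-] := Lu i; exact: (lie_flow_regular flow).
Qed.

Let flow_average_coinvariant p w : lie_span p w -> coinv_span p (flow_average phi w).
Proof.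
move=> [k [a [u [Lu ->]]]].
have ru i : flow_regular phi (u i).
  by have [w' [Ow' _] <-] := Lu i; exact: (lie_flow_regular flow).
have -> : flow_average phi (fun x v => \sum_(i < k) a i * u i x v) =
    (fun x v => \sum_(i < k) a i * flow_average phi (u i) v).
  by apply: cochain_ext => x v; exact: flow_average_sum.
apply: span_cochain_sum => i; have [w' Oc <-] := Lu i.
have [Ow' _] := Oc; rewrite (flow_average_lie flow Ow').
have -> : (fun (x : M) (v : 'I_p -> tangent x) => pullback (phi 1) w' v - w' x v) =
    (fun x v => -1 * (w' x v - pullback (rho phi 1) w' v)).
  by apply: cochain_ext => x v; rewrite mulN1r opprB.
apply: (@span_cochain_scale _ _ _ _ (-1)
  (fun x v => w' x v - pullback (rho phi 1) w' v)); apply: span_cochain_gen.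
by exists 1, w'.
Qed.

Lemma Iop_divergence : Iop phi @` divergence_forms phi `<=` coinvariant_forms phi.
Proof.
move=> _ [eta [Le [N eN]] <-]; split=> [p|]; last by exists N => p /eN; exact: Iop0.
rewrite (IopE flow); last exact/lie_span_regular/Le.
exact/span_cochain_scale/flow_average_coinvariant/Le.
Qed.

(** The cochains that are, up to sign, values of I on divergence forms. *)
Let avg_image p := [set u | exists2 w, lie_span p w & flow_average phi w = u].
Arguments avg_image : clear implicits.

Let avg_image_sum p (I : Type) (r : seq I) (a : I -> R) (u : I -> cochain M p) :
  (forall i, avg_image p (u i)) ->
  avg_image p (fun x v => \sum_(i <- r) a i * u i x v).
Proof.
move=> Au; have /choice[w wE] i : exists w, lie_span p w /\ flow_average phi w = u i.
  by have [w] := Au i; exists w.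
exists (fun x v => \sum_(i <- r) a i * w i x v).
  by apply: span_cochain_sum => i; have [] := wE i.
apply: cochain_ext => x v; rewrite flow_average_sum.
  by apply: eq_bigr => i _; have [_ <-] := wE i.
by move=> i; have [Lw _] := wE i; exact: lie_span_regular Lw.
Qed.

Let avg_image_opp p (u u' : cochain M p) : avg_image p u' ->
  (forall x v, u x v = - u' x v) -> avg_image p u.
Proof.
move=> Au uu'; have := avg_image_sum [:: tt] (fun=> -1) (fun=> Au).
by congr (avg_image p _); apply: cochain_ext => x v; rewrite big_seq1 mulN1r uu'.
Qed.

Let avg_image_step p (w : cochain M p) : @Omega_c R n M p w ->
  avg_image p (fun m v => w m v - pullback (phi 1) w v).
Proof.
move=> Oc; have [Ow _] := Oc.
apply: (@avg_image_opp _ _ (flow_average phi (lie phi w))).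
  by exists (lie phi w) => //; apply: span_cochain_gen; exists w.
by move=> x v; rewrite (flow_average_lie flow Ow) opprB.
Qed.

(** w - phi_k^* w is the telescoping sum of the forms u - phi_1^* u with
    u = phi_j^* w and j < k. *)
Let avg_image_nat p (w : cochain M p) k : @Omega_c R n M p w ->
  avg_image p (fun m v => w m v - pullback (phi k%:R) w v).
Proof.
move=> Oc; have -> : (fun m v => w m v - pullback (phi k%:R) w v) =
    (fun m v => \sum_(j < k) 1 * ((fun m v => pullback (phi j%:R) w v -
       pullback (phi 1) (pullback (phi j%:R) w) v) m v)).
  apply: cochain_ext => m v.
  under eq_bigr do rewrite mul1r -(pullback_flowD flow) natr1 -opprB.
  rewrite sumrN -(big_mkord xpredT (fun j => pullback (phi j.+1%:R) w v -
     pullback (phi j%:R) w v)) telescope_sumr // opprB.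
  by rewrite (pullback_flow0 flow).
apply: avg_image_sum => j; apply: avg_image_step.
exact: (Omega_c_pullback_flow flow).
Qed.

(** For k < 0 the form is minus the one attached to phi_k^* w and |k|. *)
Let avg_image_int p (w : cochain M p) (k : int) : @Omega_c R n M p w ->
  avg_image p (fun m v => w m v - pullback (rho phi k) w v).
Proof.
move=> Oc; have [k0|k0] := leP 0 k.
  by rewrite -(gez0_abs k0); exact: avg_image_nat.
have := avg_image_nat `|k|%N (Omega_c_pullback_flow flow k%:~R Oc).
move=> /avg_image_opp; apply => x v; rewrite -(pullback_flowD flow).
rewrite -[`|k|%N%:R]/(`|k|%N%:Z%:~R) -intrD ltz0_abs // subrr.
by rewrite (pullback_flow0 flow) opprB.
Qed.

Lemma Iop_surjective :
  set_surj (divergence_forms phi) (coinvariant_forms phi) (Iop phi).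
Proof.
move=> u [Cu [N uN]].
(* The zero form is chosen in the degrees where u vanishes, to stay in the direct
   sum. *)
have ex p : exists w : cochain M p, [/\ lie_span p w,
    (fun m v => (-1) ^+ p * flow_average phi w v) = u p &
    (N <= p)%N -> w = (fun x v => 0)].
  have [Np|pN] := leqP N p.
    exists (fun x v => 0); split => //; first exact: span_cochain0.
    by apply: cochain_ext => x v; rewrite flow_average0 mulr0 uN.
  have [k [a [v [Cv uE]]]] := Cu p.
  have Av i : avg_image p (v i).
    by have [j [w [Oc ->]]] := Cv i; exact: avg_image_int.
  have [w Lw wE] := avg_image_sum (index_enum _) (fun i => (-1) ^+ p * a i) Av.
  exists w; split=> //; apply: cochain_ext => x y; rewrite wE uE mulr_sumr.
  by apply: eq_bigr => i _; rewrite !mulrA -signr_odd -expr2 sqrr_sign mul1r.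
have [eta etaE] : exists eta : gcochain M, forall p, [/\ lie_span p (eta p),
    (fun m v => (-1) ^+ p * flow_average phi (eta p) v) = u p &
    (N <= p)%N -> eta p = (fun x v => 0)].
  by exists (fun p => sval (cid (ex p))) => p; exact: (svalP (cid (ex p))).
exists eta.
  by split=> [p|]; [have [] := etaE p|exists N => p; have [_ _] := etaE p].
apply: functional_extensionality_dep => p; have [Le E _] := etaE p.
by rewrite -E (IopE flow) //; exact: lie_span_regular.
Qed.

End Proposition.

Theorem proposition2p0p1 (R : realType) (n : nat) (M : manifold R n)
    (X : vfield M) (phi : R -> M -> M) (hphi : complete_flow X phi) :
  [/\ (forall eta, gsum (Omega M) eta -> gsum (Omega M) (Iop phi eta)),
      (forall a eta eta', gsum (Omega M) eta -> gsum (Omega M) eta' ->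
         Iop phi (glin a eta eta') = glin a (Iop phi eta) (Iop phi eta')),
      (forall eta, gsum (Omega M) eta ->
         Iop phi (gd eta) = gopp (gd (Iop phi eta))),
      Iop phi @` divergence_forms phi `<=` coinvariant_forms phi &
      set_surj (divergence_forms phi) (coinvariant_forms phi) (Iop phi)].
Proof.
split.
- exact: (Iop_Omega hphi).
- exact: (Iop_linear hphi).
- exact: (Iop_d hphi).
- exact: (Iop_divergence hphi).
- exact: (Iop_surjective hphi).
Qed.
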